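(* Let $(G,b)$, $G=(V,\vec E)$, be a connected, locally finite directed weighted graph with measure $m:V\to(0,\infty)$ such that every vertex $x$ has some $y$ with $(x,y)\in\vec E$, satisfying Assumptions $(\beta)$ and $(\gamma)$, and suppose $H=\frac12(\Delta+\Delta')$ with domain $\mathcal{C}_c(V)$ is essentially self-adjoint in $\ell^2(V,m)$. Let $S=\frac12(\overline{\Delta}+\Delta^* )$ with domain $D(\overline{\Delta})$. Then $$\sigma_{ess}(\overline{\Delta})\subseteq\{\lambda\in\mathbb{C}:\ \mathrm{Re}(\lambda)\ge\inf\sigma_{ess}(S)\},$$ and if $\sigma_{ess}(S)=\emptyset$, then $\sigma_{ess}(\overline{\Delta})=\emptyset$.
   Context: A directed weighted graph $(G,b)$, $G=(V,\vec E)$, consists of a countable vertex set $V$, a set $\vec E\subset V\times V$ of directed edges and a weight $b:V\times V\to[0,\infty)$ with $b(x,x)=0$ for all $x$ and $b(x,y)>0$ iff $(x,y)\in\vec E$ (no symmetry of $b$ is assumed). $m:V\to(0,\infty)$ is a measure on $V$. Locally finite: for each $x$ only finitely many $y$ satisfy $(x,y)\in\vec E$ or $(y,x)\in\vec E$. Connected: any two vertices are related by a path, i.e. by a finite sequence of directed edges $(x_1,y_1),\dots,(x_n,y_n)$ with $x_i=y_{i-1}$ going from one of the two vertices to the other. $\mathcal{C}_c(V)$ is the space of finitely supported functions $V\to\mathbb{C}$; $\ell^2(V,m)$ is the Hilbert space with scalar product $(f,g)_m=\sum_{x\in V}m(x)f(x)\overline{g(x)}$. On $\mathcal{C}_c(V)$: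 $\Delta f(x)=\frac1{m(x)}\sum_{y\in V}b(x,y)(f(x)-f(y))$ and $\Delta' f(x)=\frac1{m(x)}\sum_{y\in V}b(y,x)(f(x)-f(y))$. $\overline{\Delta}$ is the closure of $(\Delta,\mathcal{C}_c(V))$ in $\ell^2(V,m)$ and $\Delta^*$ is its Hilbert space adjoint. Under $(\beta)$ and $(\gamma)$ one has $D(\overline{\Delta})\subset D(\Delta^* )$; if moreover $H$ is essentially self-adjoint, $S$ is self-adjoint. Assumption $(\beta)$: for all $x\in V$, $\sum_{y\in V}b(x,y)=\sum_{y\in V}b(y,x)$. Assumption $(\gamma)$: there is a constant $M>0$ such that for all $x\in V$, $\sum_{y\in V}|b(x,y)-b(y,x)|\le M\,m(x)$. The essential spectrum $\sigma_{ess}(A)$ of a closed operator $A$ is the set of all $\lambda\in\mathbb{C}$ for which the range of $A-\lambda$ is not closed or $\dim\ker(A-\lambda)=\infty$. Convention: $\inf\emptyset=+\infty$. *)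

(* Defs.v *)
From HB Require Import structures.
From mathcomp Require Import all_boot all_order all_algebra.
From mathcomp Require Import complex.
From mathcomp Require Import boolp classical_sets functions cardinality fsbigop.
From mathcomp Require Import reals ereal interval_inference topology normedtype.
From mathcomp Require Import sequences numfun esum.
From mathcomp Require Import ring lra.

Set Implicit Arguments.
Unset Strict Implicit.
Unset Printing Implicit Defensive.

Import Order.TTheory GRing.Theory Num.Theory.
Import numFieldNormedType.Exports.
Import ComplexField.Normc.

Local Open Scope classical_set_scope.
Local Open Scope ring_scope.
Local Open Scope complex_scope.

Section Sums.
Context {R : realType} {V : choiceType}.

(* Unordered sums; the value is the intended one for absolutely summable
   families. *)
Definition real_sum (F : V -> R) : R :=
  fine (\esum_(x in [set: V]) ((EFin \o F)^\+ x)%E) -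
  fine (\esum_(x in [set: V]) ((EFin \o F)^\- x)%E).

Definition complex_sum (F : V -> R[i]) : R[i] :=
  real_sum (fun x => complex.Re (F x)) +i* real_sum (fun x => complex.Im (F x)).

End Sums.

Section L2.
Context {R : realType} {V : choiceType}.
Variable m : V -> {posnum R}.

Definition l2_sqnorm (f : V -> R[i]^o) : \bar R :=
  \esum_(x in [set: V]) ((m x)%:num * normc (f x) ^+ 2)%:E.

Definition l2_pred : {pred (V -> R[i]^o)} :=
  mem [set f | (l2_sqnorm f < +oo)%E].

Record l2 := L2 { l2_fun :> V -> R[i]^o ; _ : l2_fun \in l2_pred }.

HB.instance Definition _ := [isSub for l2_fun].
HB.instance Definition _ := [Choice of l2 by <:].

Lemma l2_sqnorm_ge0 f : (0 <= l2_sqnorm f)%E.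
Proof. by apply: esum_ge0 => x _; rewrite lee_fin mulr_ge0 ?sqr_ge0. Qed.

Lemma l2_sqnormZ (a : R[i]) f :
  l2_sqnorm (a *: f) = ((normc a ^+ 2)%:E * l2_sqnorm f)%E.
Proof.
have s0 : 0 <= normc a ^+ 2 by rewrite sqr_ge0.
have H A : (\sum_(x \in A) ((m x)%:num * normc ((a *: f) x) ^+ 2)%:E =
    (normc a ^+ 2)%:E * \sum_(x \in A) ((m x)%:num * normc (f x) ^+ 2)%:E)%E.
  rewrite ge0_mule_fsumr; last by move=> x; rewrite lee_fin mulr_ge0 ?sqr_ge0.
  apply: eq_fsbigr => x _; rewrite -EFinM; congr (_%:E).
  by rewrite [(a *: f) x]/(a * f x) normcM exprMn mulrCA.
have -> : l2_sqnorm (a *: f) = ereal_sup [set ((normc a ^+ 2)%:E * y)%E | y in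
    [set (\sum_(x \in A) ((m x)%:num * normc (f x) ^+ 2)%:E)%E
      | A in fsets [set: V]]].
  rewrite /l2_sqnorm /esum; congr ereal_sup; rewrite image_comp.
  by apply: eq_imagel => A _ /=; rewrite H.
rewrite ereal_supZl//; apply/set0P.
by exists (\sum_(x \in set0) ((m x)%:num * normc (f x) ^+ 2)%:E)%E; exists set0.
Qed.

(* |a + b|^2 <= (1 + t)|a|^2 + (1 + 1/t)|b|^2 *)
Lemma l2_sqnormD (t : R) f g : 0 < t ->
  (l2_sqnorm (f + g)%R <=
   (1 + t)%:E * l2_sqnorm f + (1 + t^-1)%:E * l2_sqnorm g)%E.
Proof.
move=> t0.
have ti0 : 0 < t^-1 by rewrite invr_gt0.
pose r := Num.sqrt (1 + t); pose s := Num.sqrt (1 + t^-1).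
have r2 : r ^+ 2 = 1 + t by rewrite sqr_sqrtr// addr_ge0// ltW.
have s2 : s ^+ 2 = 1 + t^-1 by rewrite sqr_sqrtr// addr_ge0// ltW.
have normcR (a : R) : 0 <= a -> normc a%:C = a.
  by move=> a0; rewrite /= expr0n/= addr0 sqrtr_sqr ger0_norm.
rewrite -r2 -s2 -{1}(normcR r) ?sqrtr_ge0// -{1}(normcR s) ?sqrtr_ge0//.
rewrite -!l2_sqnormZ /l2_sqnorm -esumD; first last.
- by move=> x _; rewrite lee_fin mulr_ge0 ?sqr_ge0.
- by move=> x _; rewrite lee_fin mulr_ge0 ?sqr_ge0.
apply: le_esum => x _; rewrite -EFinD lee_fin -mulrDr ler_pM2l//.
rewrite [(_%:C *: f) x]/(_%:C * f x) [(_%:C *: g) x]/(_%:C * g x).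
rewrite [(f + g) x]/(f x + g x) !normcM !normcR ?sqrtr_ge0// !exprMn r2 s2.
have n0 z : 0 <= normc z :> R by case: z => a b; rewrite sqrtr_ge0.
apply: (@le_trans _ _ ((normc (f x) + normc (g x)) ^+ 2)).
  by rewrite lerXn2r ?nnegrE ?addr_ge0 ?n0//; exact: le_normcD.
set a := normc (f x); set b := normc (g x).
rewrite -subr_ge0.
have -> : (1 + t) * a ^+ 2 + (1 + t^-1) * b ^+ 2 - (a + b) ^+ 2 =
    t^-1 * (t * a - b) ^+ 2 by field; rewrite gt_eqF.
by rewrite mulr_ge0 ?sqr_ge0// ltW.
Qed.

Lemma l2_sqnorm0 : l2_sqnorm 0 = 0%E.
Proof. by rewrite -(scale0r 0) l2_sqnormZ normc0 expr0n mul0e. Qed.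

Lemma l2_submod_closed : submod_closed l2_pred.
Proof.
split; first by rewrite inE/= l2_sqnorm0.
move=> a f g; rewrite !inE/= => fP gP.
apply: (le_lt_trans (l2_sqnormD _ _ (ltr01 : 0 < 1 :> R))).
rewrite lte_add_pinfty// ?l2_sqnormZ ?muleA -?EFinM.
  by rewrite lte_mul_pinfty// lee_fin mulr_ge0 ?addr_ge0 ?sqr_ge0.
by rewrite lte_mul_pinfty// lee_fin addr_ge0.
Qed.

HB.instance Definition _ := GRing.isSubmodClosed.Build _ _ l2_pred
  l2_submod_closed.

HB.instance Definition _ := [SubChoice_isSubLmodule of l2 by <:].

Definition l2_norm (f : l2) : R[i] := (Num.sqrt (fine (l2_sqnorm f)))%:C.

Lemma l2_sqnorm_fin (f : l2) : l2_sqnorm f \is a fin_num.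
Proof.
by rewrite ge0_fin_numE ?l2_sqnorm_ge0//; have := valP f; rewrite inE.
Qed.

Lemma l2_norm_eq0 (f : l2) : l2_norm f = 0 -> f = 0.
Proof.
case=> /eqP; rewrite sqrtr_eq0 => f0.
have {}f0 : l2_sqnorm f = 0%E.
  apply/eqP; rewrite eq_le l2_sqnorm_ge0 andbT.
  by rewrite -(fineK (l2_sqnorm_fin f)) lee_fin.
apply/val_inj/funext => x /=; apply: eq0_normc; apply/eqP.
have : (m x)%:num * normc (f x) ^+ 2 <= 0.
  rewrite -lee_fin -[leRHS]f0 /l2_sqnorm.
  rewrite (esumID [set x]); last by move=> *; rewrite lee_fin mulr_ge0 ?sqr_ge0.
  rewrite setTI esum_set1; last by rewrite lee_fin mulr_ge0 ?sqr_ge0.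
  rewrite leeDl//; apply: esum_ge0 => y _.
  by rewrite lee_fin mulr_ge0 ?sqr_ge0.
rewrite pmulr_rle0// => h; rewrite -sqrf_eq0 eq_le h sqr_ge0.
by [].
Qed.

Lemma l2_normZ (a : R[i]) (f : l2) : l2_norm (a *: f) = `|a| * l2_norm f.
Proof.
rewrite /l2_norm l2_sqnormZ fineM ?l2_sqnorm_fin//= sqrtrM ?sqr_ge0//.
rewrite sqrtr_sqr rmorphM/=; congr (_ * _).
by case: a => a b; rewrite normc_def/= ger0_norm ?sqrtr_ge0.
Qed.

Lemma l2_normD (f g : l2) : l2_norm (f + g) <= l2_norm f + l2_norm g.
Proof.
have [->|/eqP f0] := pselect (f = 0).
  by rewrite add0r lerDr lecR sqrtr_ge0.
have [->|/eqP g0] := pselect (g = 0).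
  by rewrite addr0 lerDl lecR sqrtr_ge0.
have pos (h : l2) : h != 0 -> 0 < Num.sqrt (fine (l2_sqnorm h)).
  move=> h0; rewrite lt_def sqrtr_ge0 andbT; apply: contra h0 => /eqP h0.
  by apply/eqP/l2_norm_eq0; rewrite /l2_norm h0.
rewrite /l2_norm -rmorphD lecR.
have := pos _ f0; have := pos _ g0.
have sq (h : l2) : l2_sqnorm h = (Num.sqrt (fine (l2_sqnorm h)) ^+ 2)%:E.
  by rewrite sqr_sqrtr ?fineK ?l2_sqnorm_fin// fine_ge0 ?l2_sqnorm_ge0.
have := sq f; have := sq g.
set u := Num.sqrt (fine (l2_sqnorm f)); set v := Num.sqrt (fine (l2_sqnorm g)).
move=> gv fu v0 u0.
rewrite -ler_sqr ?nnegrE ?sqrtr_ge0 ?addr_ge0 ?(ltW u0) ?(ltW v0)//.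
rewrite -lee_fin -(sq (f + g)).
have uv : 0 < v / u by rewrite divr_gt0.
apply: (le_trans (l2_sqnormD f g uv)).
rewrite fu gv -!EFinM -EFinD lee_fin le_eqVlt; apply/orP; left; apply/eqP.
by field; rewrite !gt_eqF.
Qed.

HB.instance Definition _ := Lmodule_isNormed.Build R[i] l2
  l2_normD l2_normZ l2_norm_eq0.

Definition l2_dot (f g : l2) : R[i] :=
  complex_sum (fun x => ((m x)%:num)%:C * f x * conjc (g x)).

Lemma l2_dotE (f : l2) : l2_dot f f = `|f| ^+ 2.
Proof.
have Ff x : ((m x)%:num)%:C * f x * conjc (f x) =
    ((m x)%:num * normc (f x) ^+ 2)%:C.
  case: (f x) => a b /=; rewrite sqr_sqrtr ?addr_ge0 ?sqr_ge0//.
  by apply/eqP; rewrite eq_complex/=; apply/andP; split; apply/eqP; ring.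
rewrite [`|f|]/(l2_norm f) /l2_norm -rmorphXn/= sqr_sqrtr; last first.
  by rewrite fine_ge0 ?l2_sqnorm_ge0.
rewrite /l2_dot /complex_sum /real_sum; congr (_ +i* _).
  rewrite [X in _ - fine X]esum1 ?subr0; last first.
    move=> x _; rewrite funenegE/= Ff/= max_r// lee_fin oppr_le0.
    by rewrite mulr_ge0 ?sqr_ge0.
  congr fine; apply: eq_esum => x _; rewrite funeposE/= Ff/= max_l//.
  by rewrite lee_fin mulr_ge0 ?sqr_ge0.
by rewrite !esum1 ?subrr// => x _; rewrite ?funeposE ?funenegE/= Ff/= ?oppr0 maxxx.
Qed.

End L2.

(* Unbounded operators are given by their graphs. *)
Section EssentialSpectrum.
Context {K : numFieldType} {E : normedModType K}.

Definition infinite_dim (W : set E) : Prop :=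
  forall n, exists v : 'I_n -> E, (forall i, W (v i)) /\
    forall c : 'I_n -> K, \sum_i c i *: v i = 0 -> forall i, c i = 0.

Definition op_range (A : set (E * E)) (z : K) : set E :=
  [set p.2 - z *: p.1 | p in A].

Definition op_ker (A : set (E * E)) (z : K) : set E :=
  [set f | A (f, z *: f)].

Definition ess_spectrum (A : set (E * E)) : set K :=
  [set z | ~ closed (op_range A z) \/ infinite_dim (op_ker A z)].

(* (A + B) / 2, with domain the intersection of those of A and B *)
Definition half_sum (A B : set (E * E)) : set (E * E) :=
  [set p | exists u v, [/\ A (p.1, u), B (p.1, v) & p.2 = 2^-1 *: (u + v)]].

End EssentialSpectrum.

Section Laplacian.
Context {R : realType} {V : countType}.
Implicit Types (E : rel V) (b : V -> V -> R) (m : V -> {posnum R}).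

Definition op_adjoint m (A : set (l2 m * l2 m)) : set (l2 m * l2 m) :=
  [set q | forall p, A p -> l2_dot p.2 q.1 = l2_dot p.1 q.2].

Definition essentially_self_adjoint m (A : set (l2 m * l2 m)) : Prop :=
  op_adjoint (closure A) = closure A.

Record weighted_digraph E b : Prop := WeightedDigraph {
  weight_ge0 : forall x y, 0 <= b x y ;
  weight_loop : forall x, b x x = 0 ;
  weight_gt0 : forall x y, 0 < b x y <-> E x y }.

Definition locally_finite E : Prop :=
  forall x, finite_set [set y | E x y || E y x].

Definition dipath E x y : Prop := exists s, path E x s /\ last x s = y.

(* A directed path in one of the two directions is enough. *)
Definition digraph_connected E : Prop :=
  forall x y, dipath E x y \/ dipath E y x.

Definition assumption_beta b : Prop :=
  forall x, \sum_(y \in [set: V]) b x y = \sum_(y \in [set: V]) b y x.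

Definition assumption_gamma b m : Prop :=
  exists2 M : R, 0 < M &
    forall x, \sum_(y \in [set: V]) `|b x y - b y x| <= M * (m x)%:num.

Definition laplacian b m (f : V -> R[i]) (x : V) : R[i] :=
  ((m x)%:num)^-1%:C * \sum_(y \in [set: V]) ((b x y)%:C * (f x - f y)).

(* The domain is all of C_c(V) when the graph is locally finite: the sums
   above are then finite and [laplacian b m f] is finitely supported. *)
Definition laplacian_op b m : set (l2 m * l2 m) :=
  [set p : l2 m * l2 m | finite_set [set x | p.1 x != 0] /\
                         forall x, p.2 x = laplacian b m p.1 x].

End Laplacian.

Arguments laplacian_op {R V} b m.

(* Main.v *)
(* Write K = (Delta - Delta')/2. By (beta), K f (x) is -1/(2 m(x)) times
   sum_y (b(x,y) - b(y,x)) f(y); by (gamma) and the Schur test K is bounded,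
   and it is skew-adjoint. Hence closure Delta = closure H + K, its adjoint
   is closure H - K, and S is the nonnegative self-adjoint operator A =
   closure H. Since K does not contribute to the real part of the quadratic
   form, it is enough to find c > Re z with <A f, f> >= c |f|^2 on the f in
   the domain orthogonal to finitely many vectors: there |(closure Delta -
   z) f| is at least (c - Re z) |f|, which gives a finite-dimensional kernel
   and a closed range. If Re z < 0, take c = 0. Otherwise, to avoid spectral
   measures, let T = (1 + A)^-1 and let s0 be the infimum of the s > 0 such
   that <T f, f> <= s |f|^2 on a subspace of finite codimension. If s0 >=
   1/(1 + Re z), then t = 1/s0 - 1 <= Re z is not in the essential spectrum
   of A, so T - s0 has closed range and finite-dimensional kernel and is
   therefore bounded below on a subspace of finite codimension; this allows
   s0 to be lowered. *)
Require Import Defs.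
From mathcomp Require Import all_boot all_order all_algebra.
From mathcomp Require Import complex.
From mathcomp Require finmap.
From mathcomp Require Import boolp classical_sets functions cardinality fsbigop.
From mathcomp Require Import reals ereal interval_inference topology normedtype.
From mathcomp Require Import sequences numfun esum.
From mathcomp Require Import ring lra.

Set Implicit Arguments.
Unset Strict Implicit.
Unset Printing Implicit Defensive.

Import Order.TTheory GRing.Theory Num.Theory.
Import numFieldNormedType.Exports.

Local Open Scope classical_set_scope.
Local Open Scope ring_scope.
Local Open Scope complex_scope.

(** * Hilbert spaces *)

(** The obstacle is to extract a bound on the form of [A], modulo finitely many dimensions, from
    closed ranges and finite-dimensional kernels alone. The passage to [T], which is bounded and
    everywhere defined, makes this possible: [T e] makes sense for arbitrary constraint vectors [e],
    so asking that both [f] and [T f] be orthogonal to them is again a finite list of conditions on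
    [f]. The lower bound for [T - s0] comes from the uniform boundedness principle: when the range
    of a symmetric operator is closed, the vectors to be bounded are weakly bounded. All other
    estimates are instances of Cauchy-Schwarz for forms that are nonnegative only on some subspace,
    which is why it is stated below as a fact about real quadratic polynomials. *)

Lemma discriminant_le (R : realFieldType) (a b c : R) : 0 <= a -> 0 <= c ->
  (forall r, 0 <= a + 2 * r * b + r ^+ 2 * c) -> b ^+ 2 <= a * c.
Proof.
move=> a0 c0 abc; have [cz|cn0] := eqVneq c 0.
  rewrite cz mulr0; have [->|bn0] := eqVneq b 0; first by rewrite expr0n.
  (* With [c = 0] the expression is affine in [r]; at this [r] it equals [-1], a contradiction. *)
  have := abc (- (1 + a) / (2 * b)); rewrite cz mulr0 addr0.
  have -> : 2 * (- (1 + a) / (2 * b)) * b = - (1 + a).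
    by field; rewrite bn0.
  lra.
have {cn0}cp : 0 < c by rewrite lt_def cn0.
have := abc (- b / c).
have -> : a + 2 * (- b / c) * b + (- b / c) ^+ 2 * c = (a * c - b ^+ 2) / c.
  by field; rewrite gt_eqF.
by rewrite pmulr_lge0 ?invr_gt0// subr_ge0.
Qed.

(* [rdot] stands for the real part of the inner product. Real orthogonality
   suffices throughout, since [rdotIl] recovers the imaginary part. *)
Record is_hilbert (R : realType) (E : normedModType R[i]) (rdot : E -> E -> R) :
    Prop := IsHilbert {
  rdotC : forall f g, rdot f g = rdot g f ;
  rdotDl : forall f g h, rdot (f + g) h = rdot f h + rdot g h ;
  rdotZl : forall (r : R) f g, rdot (r%:C *: f) g = r * rdot f g ;
  rdotIl : forall f g, rdot ('i *: f) g = - rdot f ('i *: g) ;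
  rdot_norm : forall f, `|f| ^+ 2 = (rdot f f)%:C ;
  rdot_complete : forall u : nat -> E,
    (forall e : R, 0 < e -> exists N, forall i j, (N <= i)%N -> (N <= j)%N ->
       rdot (u i - u j) (u i - u j) < e) ->
    exists l, forall e : R, 0 < e -> exists N, forall i, (N <= i)%N ->
       rdot (u i - l) (u i - l) < e }.

Section Hilbert.
Context {R : realType} {E : normedModType R[i]} (rdot : E -> E -> R).
Context (hE : is_hilbert rdot).
Implicit Types (f g h : E) (X : set E) (r : R).

Let dC := rdotC hE.
Let dDl := rdotDl hE.
Let dZl := rdotZl hE.

Lemma rdotDr f g h : rdot h (f + g) = rdot h f + rdot h g.
Proof. by rewrite dC dDl !(dC h). Qed.

Lemma rdotZr r f g : rdot g (r%:C *: f) = r * rdot g f.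
Proof. by rewrite dC dZl (dC g). Qed.

Lemma rdotNl f g : rdot (- f) g = - rdot f g.
Proof.
have -> : - f = (-1)%:C *: f by rewrite rmorphN1 scaleN1r.
by rewrite dZl mulN1r.
Qed.

Lemma rdotNr f g : rdot g (- f) = - rdot g f.
Proof. by rewrite dC rdotNl (dC g). Qed.

Lemma rdotBl f g h : rdot (f - g) h = rdot f h - rdot g h.
Proof. by rewrite dDl rdotNl. Qed.

Lemma rdotBr f g h : rdot h (f - g) = rdot h f - rdot h g.
Proof. by rewrite rdotDr rdotNr. Qed.

Lemma rdot0l f : rdot 0 f = 0.
Proof. by rewrite -(subrr f) rdotBl subrr. Qed.

Lemma rdot0r f : rdot f 0 = 0.
Proof. by rewrite dC rdot0l. Qed.

Lemma rdot_suml n (v : 'I_n -> E) g :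
  rdot (\sum_i v i) g = \sum_i rdot (v i) g.
Proof.
elim/big_rec2: _ => [|i x y _ <-]; first by rewrite rdot0l.
by rewrite dDl.
Qed.

Let dL := (dDl, rdotDr, rdotBl, rdotBr, rdotNl, rdotNr, dZl, rdotZr,
           rdot0l, rdot0r).

Lemma rdot_ge0 f : 0 <= rdot f f.
Proof. by rewrite -lecR -(rdot_norm hE) exprn_ge0. Qed.

Definition nm f : R := Num.sqrt (rdot f f).

Lemma nm_ge0 f : 0 <= nm f. Proof. exact: sqrtr_ge0. Qed.

Lemma nm_sqr f : nm f ^+ 2 = rdot f f.
Proof. by rewrite sqr_sqrtr ?rdot_ge0. Qed.

Lemma normE f : `|f| = (nm f)%:C.
Proof.
apply/eqP; rewrite -(@eqrXn2 _ 2) ?lecR ?nm_ge0// (rdot_norm hE).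
by rewrite -rmorphXn /= nm_sqr.
Qed.

Lemma nm0_eq0 f : nm f = 0 -> f = 0.
Proof. by move=> f0; apply/normr0_eq0; rewrite normE f0. Qed.

Lemma nm0 : nm 0 = 0.
Proof. by rewrite /nm rdot0l sqrtr0. Qed.

Lemma nm_gt0 f : f != 0 -> 0 < nm f.
Proof.
move=> f0; rewrite lt_def nm_ge0 andbT; apply: contra f0 => /eqP f0.
by apply/eqP/nm0_eq0.
Qed.

Lemma nmD f g : nm (f + g) <= nm f + nm g.
Proof. by rewrite -lecR rmorphD/= -!normE ler_normD. Qed.

Lemma nmN f : nm (- f) = nm f.
Proof. by rewrite /nm !dL opprK. Qed.

Lemma nmB f g : nm (f - g) <= nm f + nm g.
Proof. by rewrite -(nmN g) nmD. Qed.

Lemma nm_distC f g : nm (f - g) = nm (g - f).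
Proof. by rewrite -nmN opprB. Qed.

Lemma nm_triangle h f g : nm (f - g) <= nm (f - h) + nm (h - g).
Proof. by rewrite -{1}(subrK h f) -addrA nmD. Qed.

Lemma nmZ r f : nm (r%:C *: f) = `|r| * nm f.
Proof. by rewrite /nm !dL mulrA -expr2 sqrtrM ?sqr_ge0// sqrtr_sqr. Qed.

Lemma nmZc (z : R[i]) f : nm (z *: f) = complex.Re `|z| * nm f.
Proof.
have := normrZ z f; rewrite !normE; case: z => a b; rewrite normc_def/=.
by case; rewrite !mul0r subr0.
Qed.

Lemma cauchy_schwarz f g : `|rdot f g| <= nm f * nm g.
Proof.
rewrite -ler_sqr ?nnegrE ?mulr_ge0 ?nm_ge0//.
rewrite real_normK ?num_real// exprMn !nm_sqr.
apply: discriminant_le; rewrite ?rdot_ge0// => r.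
have := rdot_ge0 (f + r%:C *: g); rewrite !dL (dC g f).
by congr (0 <= _); ring.
Qed.

Lemma rdot_le f g : rdot f g <= nm f * nm g.
Proof. by apply: le_trans (cauchy_schwarz f g); rewrite ler_norm. Qed.

Lemma parallelogram f g :
  nm (f - g) ^+ 2 + nm (f + g) ^+ 2 = 2 * (nm f ^+ 2 + nm g ^+ 2).
Proof. by rewrite !nm_sqr !dL (dC g f); ring. Qed.

Lemma ball_nmE f r g : 0 < r -> ball f r%:C g <-> nm (f - g) < r.
Proof. by move=> r0; rewrite -ball_normE /ball_ /= normE ltcR. Qed.

Lemma nbhs_nmP f (A : set E) :
  nbhs f A <-> exists2 r : R, 0 < r & forall g, nm (f - g) < r -> A g.
Proof.
split.
  move=> /nbhs_ballP[[a b]]/=; rewrite ltcE/= => /andP[/eqP-> a0] hA.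
  exists a => // g fg; apply: hA; exact/(ball_nmE f g a0).
move=> [r r0 hA]; apply/nbhs_ballP; exists r%:C => /=; first by rewrite ltcR.
by move=> g /(ball_nmE f g r0) /hA.
Qed.

Lemma closure_nmP (A : set E) f :
  closure A f <-> forall e, 0 < e -> exists2 g, A g & nm (f - g) < e.
Proof.
split=> [clA e e0|h B /nbhs_nmP[r r0 rB]].
  have /clA[g [Ag]] : nbhs f [set g | nm (f - g) < e].
    by apply/nbhs_nmP; exists e.
  by exists g.
by have [g Ag /rB Bg] := h _ r0; exists g.
Qed.

Lemma closure_nmP2 (A : set (E * E)) p :
  closure A p <-> forall e, 0 < e ->
    exists2 q, A q & nm (p.1 - q.1) < e /\ nm (p.2 - q.2) < e.
Proof.
split=> [clA e e0|h B [[B1 B2]/= [/nbhs_nmP[r r0 rB] /nbhs_nmP[s s0 sB]] B12]].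
  have /clA[q [Aq []]] :
      nbhs p ([set g | nm (p.1 - g) < e] `*` [set g | nm (p.2 - g) < e]).
    by exists ([set g | nm (p.1 - g) < e], [set g | nm (p.2 - g) < e]) => //;
      split; apply/nbhs_nmP; exists e.
  by exists q.
have [|q Aq [q1 q2]] := h (Num.min r s); first by rewrite lt_min r0.
exists q; split=> //; apply: B12; move: q1 q2; rewrite !lt_min.
by move=> /andP[/rB ? _] /andP[_ /sB ?].
Qed.

Lemma invS_lt (e : R) : 0 < e ->
  exists N, forall n, (N <= n)%N -> (n.+1%:R : R)^-1 < e.
Proof.
move=> e0; exists (Num.bound e^-1) => n Nn.
rewrite invf_plt ?posrE//; apply: (lt_le_trans (archi_boundP _)).
  by rewrite invr_ge0 ltW.
by rewrite ler_nat ltnW.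
Qed.

Lemma nm_complete (u : nat -> E) :
  (forall e : R, 0 < e -> exists N, forall i j, (N <= i)%N -> (N <= j)%N ->
     nm (u i - u j) < e) ->
  exists l, forall e : R, 0 < e -> exists N, forall i, (N <= i)%N ->
     nm (u i - l) < e.
Proof.
move=> cu; have [e e0|l ul] := rdot_complete hE (u := u).
  have [|N uN] := cu (Num.sqrt e); first by rewrite sqrtr_gt0.
  exists N => i j Ni Nj; have := uN i j Ni Nj.
  by rewrite /nm ltr_sqrt.
exists l => e e0; have [|N uN] := ul (e ^+ 2); first by rewrite exprn_gt0.
exists N => i /uN; rewrite -nm_sqr ltr_pXn2r ?nnegrE ?nm_ge0//; exact: ltW.
Qed.

Definition real_subspace X : Prop := [/\ X 0,
  forall f g, X f -> X g -> X (f + g) & forall r f, X f -> X (r%:C *: f)].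

(* A minimizing sequence for the distance is Cauchy by the parallelogram law,
   and almost minimality makes [h - x n] almost orthogonal to [X]. *)
Lemma orthogonal_projection X h : real_subspace X -> closed X ->
  exists2 p, X p & forall x, X x -> rdot (h - p) x = 0.
Proof.
move=> [X0 XD XZ] clX.
pose S := [set nm (h - x) ^+ 2 | x in X]; pose d := inf S.
have S0 : S !=set0 by exists (nm (h - 0) ^+ 2), 0.
have Sb : has_inf S by split=> //; exists 0 => _ [x _ <-]; rewrite sqr_ge0.
have dle x : X x -> d <= nm (h - x) ^+ 2.
  by move=> Xx; apply: ge_inf; [case: Sb|exists x].
have /choice[x Hx] : forall n, exists x,
    X x /\ nm (h - x) ^+ 2 < d + (n.+1%:R)^-1.
  move=> n; have [|_ [x Xx <-] xd] := @inf_adherent _ S (n.+1%:R)^-1 _ Sb.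
    by rewrite invr_gt0 ltr0n.
  by exists x.
have cx : forall e : R, 0 < e -> exists N, forall i j, (N <= i)%N -> (N <= j)%N ->
     nm (x i - x j) < e.
  (* The parallelogram law bounds the squared distance by [2 / i.+1 + 2 / j.+1]. *)
  move=> e e0; have [|N HN] := @invS_lt (e ^+ 2 / 4).
    by rewrite divr_gt0// exprn_gt0.
  exists N => i j /HN Ni /HN Nj.
  rewrite -(@ltr_pXn2r _ 2) ?nnegrE ?nm_ge0 ?ltW//.
  have := parallelogram (h - x j) (h - x i).
  have -> : h - x j - (h - x i) = x i - x j by rewrite opprB addrC addrA subrK.
  have -> : h - x j + (h - x i) = 2%:R%:C *: (h - 2%:R^-1%:C *: (x i + x j)).
    rewrite scalerBr scalerA -rmorphM/= divff ?pnatr_eq0// scale1r.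
    by rewrite rmorph_nat scaler_nat mulr2n opprD addrACA (addrC (- x j)).
  rewrite nmZ exprMn ger0_norm// => eq2.
  have [Xi hi] := Hx i; have [Xj hj] := Hx j.
  have := dle _ (XZ 2%:R^-1 _ (XD _ _ Xi Xj)).
  move: Ni Nj hi hj eq2; move: (i.+1%:R^-1 : R) (j.+1%:R^-1 : R) => vi vj; lra.
have [p xp] := nm_complete cx.
have Xp : X p.
  apply: clX; apply/closure_nmP => e /xp[N /(_ N (leqnn _)) xN].
  by exists (x N); [have [] := Hx N|rewrite nm_distC].
exists p => // y Xy; apply/eqP/contraT => hpy.
(* For all real [r], [d <= |h - x n + r y|^2], while [|h - x n|^2 < d + 1 / n.+1]; so the polynomial
   in [r] with constant term [1 / n.+1] is nonnegative. *)
have small n : `|rdot (h - x n) y| <= Num.sqrt (n.+1%:R)^-1 * nm y.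
  rewrite -ler_sqr ?nnegrE ?mulr_ge0 ?nm_ge0 ?sqrtr_ge0//.
  rewrite exprMn sqr_sqrtr ?invr_ge0// real_normK ?num_real//.
  apply: discriminant_le; rewrite ?invr_ge0 ?sqr_ge0// => r.
  have [Xn hn] := Hx n.
  have := dle _ (XD _ _ Xn (XZ (- r) _ Xy)).
  have -> : h - (x n + (- r)%:C *: y) = (h - x n) + r%:C *: y.
    by rewrite rmorphN/= scaleNr opprD opprK addrA.
  move: hn; rewrite !nm_sqr !dL (dC y h) (dC y (x n)) (dC (x n) h).
  move: (n.+1%:R^-1 : R) => v; lra.
have y0 : 0 < nm y.
  by apply: nm_gt0; apply: contra hpy => /eqP ->; rewrite rdot0r.
pose e := `|rdot (h - p) y| / nm y.
have e0 : 0 < e by rewrite divr_gt0// normr_gt0.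
have e2 : 0 < e / 2 by rewrite divr_gt0.
have [|N HN] := @invS_lt ((e / 2) ^+ 2); first by rewrite exprn_gt0.
have [N' HN'] := xp _ e2.
pose n := maxn N N'.
have : `|rdot (h - p) y| <= `|rdot (h - x n) y| + nm (x n - p) * nm y.
  have -> : rdot (h - p) y = rdot (h - x n) y + rdot (x n - p) y.
    by rewrite !dL; ring.
  by apply: (le_trans (ler_normD _ _)); rewrite lerD2l cauchy_schwarz.
apply: contraTT => _; rewrite -ltNge.
apply: (@lt_le_trans _ _ (e / 2 * nm y + e / 2 * nm y)); last first.
  by rewrite -mulrDl -splitr /e divfK// gt_eqF.
apply: ltrD; last by rewrite ltr_pM2r// HN' // leq_maxr.
apply: (le_lt_trans (small n)); rewrite ltr_pM2r//.
rewrite -(@ltr_pXn2r _ 2) ?nnegrE ?sqrtr_ge0 ?(ltW e2)//.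
by rewrite sqr_sqrtr ?invr_ge0// HN// leq_maxl.
Qed.

(* Gliding hump: if [|F n| > 2 n 3^n], move [x n] by [3^-n] so that
   [<x n.+1, F n>] is large; later moves are too small to undo this. *)
Lemma uniform_boundedness (Phi : set E) :
  (forall h, exists C : R, forall f, Phi f -> `|rdot h f| <= C) ->
  exists C : R, forall f, Phi f -> nm f <= C.
Proof.
move=> pb; apply: contrapT => unb.
have /choice[F HF] : forall n : nat, exists f,
    Phi f /\ 2 * n%:R * 3 ^+ n < nm f.
  move=> n; apply: contrapT => nf; apply: unb; exists (2 * n%:R * 3 ^+ n).
  move=> f Pf; rewrite leNgt; apply/negP => fn; apply: nf.
  by exists f.
pose w n : R := (3 ^+ n)^-1.
have w0 n : 0 < w n by rewrite invr_gt0 exprn_gt0.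
have wS n : w n = 3 * w n.+1.
  by rewrite /w exprS invfM mulrA divff ?mul1r// pnatr_eq0.
(* Adding or subtracting the multiple of [F n] of norm [w n], according to the sign of [<x, F n>],
   excludes cancellation. *)
have step n x : exists y, nm (y - x) <= w n /\ w n * nm (F n) <= `|rdot y (F n)|.
  set f := F n; have [->|f0] := eqVneq f 0.
    by exists x; rewrite subrr nm0 mulr0 normr_ge0; split=> //; exact: ltW.
  have nf0 := nm_gt0 f0.
  pose z := (w n / nm f)%:C *: f.
  have nz : nm z = w n.
    by rewrite nmZ ger0_norm ?divfK ?gt_eqF// divr_ge0 ?nm_ge0// ltW.
  have zf : rdot z f = w n * nm f.
    by rewrite dZl -nm_sqr; field; rewrite gt_eqF.
  have [pos|neg] := leP 0 (rdot x f).
    exists (x + z); rewrite addrAC subrr add0r nz; split=> //.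
    by rewrite dDl zf; apply: le_trans (ler_norm _); rewrite lerDr.
  exists (x - z); rewrite addrAC subrr add0r nmN nz; split=> //.
  rewrite rdotBl zf -normrN opprB; apply: le_trans (ler_norm _).
  by rewrite lerDl oppr_ge0 ltW.
have /choice[st Hst] : forall nx : nat * E, exists y,
    nm (y - nx.2) <= w nx.1 /\ w nx.1 * nm (F nx.1) <= `|rdot y (F nx.1)|.
  by move=> [n x]; exact: step.
pose x := fix x n := if n is n'.+1 then st (n', x n') else 0.
have xS n : nm (x n.+1 - x n) <= w n /\ w n * nm (F n) <= `|rdot (x n.+1) (F n)|.
  exact: (Hst (n, x n)).
have tele n k : nm (x (n + k)%N - x n) + 3 / 2 * w (n + k)%N <= 3 / 2 * w n.
  elim: k => [|k IH]; first by rewrite addn0 subrr nm0 add0r.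
  rewrite addnS; have [h1 _] := xS (n + k)%N.
  have := nm_triangle (x (n + k)%N) (x (n + k).+1) (x n).
  have := wS (n + k)%N; lra.
have tele' n k : (n <= k)%N -> nm (x k - x n) <= 3 / 2 * w n.
  by move=> nk; have := tele n (k - n)%N; rewrite subnKC//; have := w0 k; lra.
have wle n : w n <= (n.+1%:R)^-1.
  rewrite /w lef_pV2 ?posrE ?exprn_gt0 ?ltr0n// -natrX ler_nat.
  exact: ltn_expl.
have cx : forall e : R, 0 < e -> exists N, forall i j, (N <= i)%N -> (N <= j)%N ->
    nm (x i - x j) < e.
  move=> e e0; have [|N HN] := @invS_lt (e / 3); first by rewrite divr_gt0.
  exists N => i j /tele' xi /tele' xj.
  have := nm_triangle (x N) (x i) (x j); rewrite (nm_distC (x N)).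
  have := HN N (leqnn N); have := wle N; move: (N.+1%:R^-1 : R) => v; lra.
have [l xl] := nm_complete cx.
(* The moves after [x n.+1] sum to at most [3 / 2 * w n.+1 = w n / 2], so at least half of
   [w n * nm (F n)], hence more than [n], survives in [<l, F n>]. *)
have lx n : nm (l - x n.+1) <= 1 / 2 * w n.
  apply/ler_addgt0Pl => e /xl[N /(_ (maxn N n.+1)) xN].
  have := tele' n.+1 (maxn N n.+1) (leq_maxr _ _).
  have := nm_triangle (x (maxn N n.+1)) l (x n.+1).
  have := xN (leq_maxl _ _); rewrite nm_distC; have := wS n; lra.
have [C HC] := pb l.
have [n nC] : exists n : nat, C < n%:R.
  exists (Num.bound `|C|); apply: le_lt_trans (ler_norm _) _.
  by apply: archi_boundP.
have [Pn Fn] := HF n; have := HC _ Pn; apply/negP; rewrite -ltNge.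
apply: (lt_trans nC); have [_ h1] := xS n.
have h2 : `|rdot (l - x n.+1) (F n)| <= 1 / 2 * w n * nm (F n).
  apply: (le_trans (cauchy_schwarz _ _)).
  by apply: ler_wpM2r; [exact: nm_ge0|exact: lx].
have h3 : `|rdot (x n.+1) (F n)| <= `|rdot l (F n)| + `|rdot (l - x n.+1) (F n)|.
  rewrite -[X in `|X|](_ : rdot l (F n) - rdot (l - x n.+1) (F n) = _).
    exact: ler_normB.
  by rewrite rdotBl; ring.
have h4 : 2 * n%:R < w n * nm (F n).
  by rewrite /w [ltRHS]mulrC ltr_pdivlMr ?exprn_gt0.
lra.
Qed.

(** * Closed ranges and lower bounds on subspaces of finite codimension *)

(** Only the component [q] of [w] orthogonal to [X] matters: if it is nonzero, the coefficient of
    [w] is the continuous functional [a], so removing the part along [w] respects limits.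
    [closed_range] uses this to restore one dimension at a time. *)
Lemma closed_add_line X w : real_subspace X -> closed X ->
  closed [set f | exists r, X (f - r%:C *: w)].
Proof.
move=> sX clX; have [p Xp wp] := orthogonal_projection w sX clX.
have [X0 XD XZ] := sX.
pose q := w - p; have [qz|q0] := eqVneq q 0.
  have -> : [set f | exists r, X (f - r%:C *: w)] = X => //.
  have Xw : X w by rewrite -(subrK p w) -/q qz add0r.
  apply/seteqP; split=> [f [r Xf]|f Xf].
    by rewrite -(subrK (r%:C *: w) f); exact: XD _ _ Xf (XZ _ _ Xw).
  by exists 0; rewrite scale0r subr0.
have nq := nm_gt0 q0; have Xq x : X x -> rdot x q = 0 by rewrite dC; exact: wp.
have wq : rdot w q = nm q ^+ 2.
  by rewrite nm_sqr {2}/q rdotBl [rdot p q]Xq// subr0.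
pose a f := rdot f q / nm q ^+ 2.
have aE f r : X (f - r%:C *: w) -> r = a f.
  move=> /Xq; rewrite rdotBl dZl wq => /eqP; rewrite subr_eq0 => /eqP fq.
  by rewrite /a fq mulfK// expf_neq0// gt_eqF.
move=> f /closure_nmP clf; exists (a f); apply: clX; apply/closure_nmP => e e0.
(* [c] bounds the norm of the map sending [f] to [f - (a f)%:C *: w]. *)
pose c := 1 + nm w / nm q.
have c0 : 0 < c by rewrite /c ltr_wpDr// divr_ge0 ?nm_ge0.
have [|g [r Xg] fg] := clf (e / c); first by rewrite divr_gt0.
exists (g - r%:C *: w) => //; rewrite (aE _ _ Xg).
have -> : f - (a f)%:C *: w - (g - (a g)%:C *: w) =
    (f - g) - (a f - a g)%:C *: w.
  rewrite rmorphB/= scalerBl !opprB addrACA [RHS]addrACA.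
  by congr (_ + _); rewrite addrC.
apply: (le_lt_trans (nmB _ _)); rewrite nmZ.
have -> : a f - a g = rdot (f - g) q / nm q ^+ 2 by rewrite /a rdotBl mulrBl.
apply: (@le_lt_trans _ _ (nm (f - g) * c)); last by rewrite -ltr_pdivlMr.
rewrite /c mulrDr mulr1 lerD2l normrM normfV (ger0_norm (sqr_ge0 _)).
have := cauchy_schwarz (f - g) q; set z := `|_| => hz.
apply: (@le_trans _ _ (nm (f - g) * nm q / nm q ^+ 2 * nm w)).
  by rewrite ler_wpM2r ?nm_ge0// ler_wpM2r// invr_ge0 sqr_ge0.
rewrite le_eqVlt; apply/orP; left; apply/eqP; field.
by rewrite gt_eqF.
Qed.

Lemma rdotZlc (z : R[i]) f g :
  rdot (z *: f) g = complex.Re z * rdot f g + complex.Im z * rdot ('i *: f) g.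
Proof.
by rewrite {1}(complexE z) scalerDl [_ * _]mulrC -scalerA dDl !dZl.
Qed.

(** Multiplication by ['i] is skew for [rdot], so the imaginary part of [z] drops out; this is why
    only real parts of spectral parameters enter the estimates. *)
Lemma rdotZ_diag (z : R[i]) f : rdot (z *: f) f = complex.Re z * rdot f f.
Proof.
have : rdot ('i *: f) f = - rdot ('i *: f) f by rewrite {1}(rdotIl hE) dC.
by rewrite rdotZlc => ?; have -> : rdot ('i *: f) f = 0; [lra|rewrite mulr0 addr0].
Qed.

Definition perp (s : seq E) f : Prop := forall e, e \in s -> rdot f e = 0.

Lemma perp_cat s t f : perp (s ++ t) f <-> perp s f /\ perp t f.
Proof.
split=> [h|[hs ht] e]; last by rewrite mem_cat => /orP[/hs|/ht].
by split=> e es; apply: h; rewrite mem_cat es ?orbT.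
Qed.

(** The matrix of pairings has more rows than columns, so its left kernel is nonzero. Applied to
    independent vectors of an infinite-dimensional kernel, this gives a nonzero kernel element in
    [perp s]. *)
Lemma perp_combination n (v : 'I_n -> E) (s : seq E) : (size s < n)%N ->
  exists c : 'I_n -> R, (exists i, c i != 0) /\ perp s (\sum_i (c i)%:C *: v i).
Proof.
move=> sn; pose M : 'M[R]_(n, size s) := \matrix_(i, j) rdot (v i) s`_j.
have : kermx M != 0.
  rewrite -mxrank_eq0 mxrank_ker subn_eq0 -ltnNge.
  by apply: leq_ltn_trans sn; exact: rank_leq_col.
move=> /rowV0Pn[c /sub_kermxP cM c0]; exists (c 0); split.
  by have /rV0Pn[i ci] := c0; exists i.
move=> e es; rewrite rdot_suml.
have je : (index e s < size s)%N by rewrite index_mem.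
have := congr1 (fun A : 'rV_(size s) => A 0 (Ordinal je)) cM; rewrite !mxE => cMj.
rewrite -[RHS]cMj; apply: eq_bigr => i _.
by rewrite !mxE/= nth_index// dZl.
Qed.

(** Every element of [W] is a complex combination of a free family of maximal length. As [rdot] sees
    only real parts, orthogonality to these combinations takes the vectors [v i] and also
    ['i *: v i]. *)
Lemma finite_dim_perp (W : set E) : ~ infinite_dim W ->
  exists s, forall f, perp s f -> forall w, W w -> rdot f w = 0.
Proof.
pose free n (v : 'I_n -> E) := (forall i, W (v i)) /\
  forall c : 'I_n -> R[i], \sum_i c i *: v i = 0 -> forall i, c i = 0.
move=> Wfin.
have [n [[v [Wv vfree]] nS]] : exists n, (exists v : 'I_n -> E, free n v) /\
    ~ exists v : 'I_n.+1 -> E, free n.+1 v.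
  apply: contrapT => h; apply: Wfin; elim=> [|n IH].
    by exists (fun=> 0); split=> [[]|? ? []].
  by apply: contrapT => nS; apply: h; exists n.
exists (codom v ++ codom (fun i => 'i *: v i)) => f /perp_cat[fv fiv] w Ww.
have [c c0] : exists c : 'I_n -> R[i], w = \sum_i c i *: v i.
  apply: contrapT => wv; apply: nS.
  exists (fun i => if unlift ord0 i is Some j then v j else w); split.
    by move=> i; case: unliftP.
  move=> c; rewrite big_ord_recl unlift_none.
  under eq_bigr do rewrite liftK.
  have [c00|c00] := eqVneq (c ord0) 0.
    rewrite c00 scale0r add0r => /vfree cl i.
    by case: (unliftP ord0 i) => [j|] ->.
  move=> /eqP; rewrite addr_eq0 => /eqP cw; case: wv.
  exists (fun i => - (c ord0)^-1 * c (lift ord0 i)).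
  under eq_bigr do rewrite -scalerA.
  by rewrite -scaler_sumr scaleNr -scalerN -cw scalerA mulVf// scale1r.
rewrite c0 dC rdot_suml big1// => i _; rewrite rdotZlc !(dC _ f).
by rewrite fv ?codom_f// fiv ?codom_f// !mulr0 addr0.
Qed.

(** Scalars are real because the induction in [closed_range] cuts a graph by a real hyperplane
    [rdot p.1 e = 0], which is in general not stable under ['i]. *)
Definition real_graph (G : set (E * E)) : Prop := [/\ G (0, 0),
  forall p q, G p -> G q -> G (p.1 + q.1, p.2 + q.2) &
  forall r p, G p -> G (r%:C *: p.1, r%:C *: p.2)].

(** Without constraints, preimages of a convergent sequence are Cauchy by the estimate, and
    closedness of [G] supplies the limit. One more constraint [e] cuts [G] down to [G'], and the
    range of [G] is that of [G'] plus at most one line, spanned by [p0.2]. *)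
Lemma closed_range s G (C : R) : real_graph G -> closed G ->
  (forall p, G p -> perp s p.1 -> nm p.1 <= C * nm p.2) ->
  closed [set p.2 | p in G].
Proof.
elim: s G => [|e s IH] G rG clG GC.
  have [G0 GD GZ] := rG.
  move=> f /closure_nmP clf.
  have /choice[p Hp] : forall n, exists p,
      G p /\ nm (f - p.2) < (n.+1%:R)^-1.
    move=> n; have [|_ [p Gp <-] fp] := clf (n.+1%:R)^-1.
      by rewrite invr_gt0 ltr0n.
    by exists p.
  have [e e0|l pl] := @nm_complete (fun n => (p n).1).
    pose c := 1 + `|C|; have c0 : 0 < c by rewrite /c ltr_wpDr.
    have [|N HN] := @invS_lt (e / (2 * c)); first by rewrite divr_gt0 ?mulr_gt0.
    exists N => i j /HN Ni /HN Nj; have [Gi fi] := Hp i; have [Gj fj] := Hp j.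
    have Gij := GD _ _ Gi (GZ (-1) _ Gj).
    have := GC _ Gij; rewrite /= !rmorphN1 !scaleN1r => /(_ _)/le_lt_trans; apply.
      by [].
    apply: (@le_lt_trans _ _ (c * nm ((p i).2 - (p j).2))).
      by rewrite ler_wpM2r ?nm_ge0// /c; have := ler_norm C; lra.
    rewrite mulrC -ltr_pdivlMr//.
    have := nm_triangle f (p i).2 (p j).2; rewrite (nm_distC _ f) => h.
    have -> : e / c = e / (2 * c) + e / (2 * c) by field; rewrite gt_eqF.
    by apply: (le_lt_trans h); apply: ltrD; [exact: lt_trans Ni|exact: lt_trans Nj].
  exists (l, f) => //; apply: clG; apply/closure_nmP2 => e e0.
  have [N HN] := pl _ e0; have [N' HN'] := invS_lt e0.
  pose n := maxn N N'; have [Gn fn] := Hp n.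
  exists (p n) => //=; split; first by rewrite nm_distC HN// leq_maxl.
  by apply: (lt_trans fn); rewrite HN'// leq_maxr.
pose G' := [set p | G p /\ rdot p.1 e = 0].
have [G0 GD GZ] := rG.
have rG' : real_graph G'.
  split; first by split=> //=; rewrite rdot0l.
    by move=> p q [Gp pe] [Gq qe]; split=> /=; [exact: GD|rewrite dDl pe qe addr0].
  by move=> r p [Gp pe]; split=> /=; [exact: GZ|rewrite dZl pe mulr0].
have clG' : closed G'.
  move=> p /closure_nmP2 clp; split.
    apply: clG; apply/closure_nmP2 => x /clp[q [Gq _] qx].
    by exists q.
  apply/eqP/contraT => pe.
  have n0 : 0 < `|rdot p.1 e| by rewrite normr_gt0.
  have c0 : 0 < 1 + nm e by rewrite ltr_wpDr ?nm_ge0.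
  have [|q [Gq qe] [q1 _]] := clp (`|rdot p.1 e| / (1 + nm e)).
    by rewrite divr_gt0.
  have := cauchy_schwarz (p.1 - q.1) e; rewrite rdotBl qe subr0.
  move: q1; rewrite ltr_pdivlMr// => q1 h; have := nm_ge0 (p.1 - q.1).
  lra.
have clR' : closed [set p.2 | p in G'].
  apply: (IH G') => // p [Gp pe] ps; apply: GC => // x.
  by rewrite inE => /orP[/eqP ->|/ps].
have [all0|] := pselect (forall p, G p -> rdot p.1 e = 0).
  suff <- : G' = G by [].
  by apply/seteqP; split=> [p []//|p Gp]; split=> //; exact: all0.
move=> /existsNP[p0 /not_implyP[Gp0 /eqP p0e]].
have -> : [set p.2 | p in G] =
    [set f | exists r, [set p.2 | p in G'] (f - r%:C *: p0.2)].
  apply/seteqP; split=> [_ [p Gp <-]|f [r [p [Gp pe] pf]]].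
    exists (rdot p.1 e / rdot p0.1 e).
    have := GD _ _ Gp (GZ (- (rdot p.1 e / rdot p0.1 e)) _ Gp0).
    rewrite !rmorphN !scaleNr => Gq; eexists; first split; first exact: Gq.
      by rewrite /= rdotBl dZl; field.
    by [].
  have := GD _ _ Gp (GZ r _ Gp0) => Gq; eexists; first exact: Gq.
  by rewrite /= pf subrK.
apply: closed_add_line => //; have [G0' GD' GZ'] := rG'; split.
- by exists (0, 0).
- by move=> _ _ [p Gp <-] [q Gq <-]; eexists; first exact: GD' Gp Gq.
- by move=> r _ [p Gp <-]; eexists; first exact: GZ' r _ Gp.
Qed.

Definition real_linear (B : E -> E) : Prop :=
  (forall f g, B (f + g) = B f + B g) /\ forall r f, B (r%:C *: f) = r%:C *: B f.

Definition symmetric (B : E -> E) : Prop :=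
  forall f g, rdot (B f) g = rdot f (B g).

(** Project [h] to [B u] on the closed range. By symmetry [h - B u] lies in the kernel of [B], so
    for [f] in [perp s] with [|B f| <= 1] one gets [<h, f> = <B u, f> = <u, B f> <= |u|]. Such [f]
    are thus weakly bounded, hence bounded in norm, and scaling gives [d]. *)
Lemma symmetric_bounded_below (B : E -> E) s :
  real_linear B -> symmetric B -> closed (range B) ->
  (forall f, perp s f -> forall w, B w = 0 -> rdot f w = 0) ->
  exists2 d : R, 0 < d & forall f, perp s f -> d * nm f <= nm (B f).
Proof.
move=> [BD BZ] Bsym clB sB.
have B0 : B 0 = 0 by have := BZ 0 0; rewrite rmorph0 !scale0r.
have rB : real_subspace (range B).
  split; first by exists 0.
    by move=> _ _ [f _ <-] [g _ <-]; exists (f + g).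
  by move=> r _ [f _ <-]; exists (r%:C *: f).
have [h|C HC] := @uniform_boundedness [set f | perp s f /\ nm (B f) <= 1].
  have [_ [u _ <-] hu] := orthogonal_projection h rB clB.
  exists (nm u) => f [fs Bf1].
  have B0h : B (h - B u) = 0.
    have hB := hu _ (imageT B (B (h - B u))).
    by apply: nm0_eq0; rewrite /nm Bsym hB sqrtr0.
  have := sB _ fs _ B0h; rewrite dC rdotBl => /eqP; rewrite subr_eq0 => /eqP ->.
  rewrite Bsym; apply: (le_trans (cauchy_schwarz _ _)).
  by rewrite ler_piMr ?nm_ge0.
exists (1 + `|C|)^-1; first by rewrite invr_gt0 ltr_wpDr.
move=> f fs; have [Bf0|Bf0] := eqVneq (B f) 0.
  have -> : f = 0 by apply: nm0_eq0; rewrite /nm (sB _ fs _ Bf0) sqrtr0.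
  by rewrite nm0 mulr0 nm_ge0.
have nb := nm_gt0 Bf0.
have := HC ((nm (B f))^-1%:C *: f); rewrite nmZ.
rewrite [`|_|]ger0_norm ?invr_ge0 ?nm_ge0// => /(_ _).
rewrite mulrC ler_pdivrMr// => h; rewrite mulrC ler_pdivrMr ?ltr_wpDr//.
apply: le_trans (h _) _.
  split; first by move=> e /fs fe; rewrite dZl fe mulr0.
  by rewrite BZ nmZ ger0_norm ?invr_ge0 ?nm_ge0// mulVf ?gt_eqF.
by rewrite mulrC ler_wpM2l ?nm_ge0//; have := ler_norm C; lra.
Qed.

(* With [A = s0 + eps - T], nonnegative on [perp e], Cauchy-Schwarz for the
   form [<A f, g>] gives [|A f|^2 <= |A| <A f, f>] as soon as [A f] is again
   in [perp e], i.e. for [f] in [perp (e ++ map T e)]. *)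
Lemma lower_top_form (T : E -> E) (s0 d : R) s :
  real_linear T -> symmetric T -> (forall f, nm (T f) <= nm f) ->
  0 <= s0 -> 0 < d ->
  (forall f, perp s f -> d * nm f <= nm (T f - s0%:C *: f)) ->
  (forall eps, 0 < eps -> exists e, forall f, perp e f ->
     rdot (T f) f <= (s0 + eps) * nm f ^+ 2) ->
  exists2 s1, s1 < s0 & exists e, forall f, perp e f ->
     rdot (T f) f <= s1 * nm f ^+ 2.
Proof.
move=> [TD TZ] Tsym T1 s00 d0 sd approx.
(* [M] bounds the norm of [A], since [eps <= 1]. From [eps <= d / 2] follows [|A f| >= (d / 2) |f|],
   so [<A f, f>] is at least [d^2 / (4 M) = 2 g] times [|f|^2]; one [g] pays for [eps], the other is
   the gain. *)
pose M := s0 + 2; have M0 : 0 < M by rewrite /M; lra.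
pose g := d ^+ 2 / (8 * M); have g0 : 0 < g by rewrite divr_gt0 ?exprn_gt0 ?mulr_gt0.
pose eps := Num.min 1 (Num.min (d / 2) g).
have eps0 : 0 < eps by rewrite !lt_min ltr01 g0 divr_gt0.
have eps1 : eps <= 1 by rewrite ge_min lexx.
have epsd : eps <= d / 2 by rewrite !ge_min lexx orbT.
have epsg : eps <= g by rewrite !ge_min lexx !orbT.
have [e He] := approx _ eps0.
exists (s0 - g); first by rewrite ltrBlDr ltrDl.
exists (s ++ (e ++ map T e)) => f /perp_cat[fs /perp_cat[fe fTe]].
pose A h := (s0 + eps)%:C *: h - T h.
have AE h k : rdot (A h) k = (s0 + eps) * rdot h k - rdot (T h) k.
  by rewrite /A rdotBl dZl.
have Alin h r k : A (h + r%:C *: k) = A h + r%:C *: A k.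
  rewrite /A TD TZ scalerDr scalerBr !scalerA [_ * r%:C]mulrC opprD.
  by rewrite addrACA.
have Asym h k : rdot (A h) k = rdot h (A k).
  by rewrite AE [RHS]dC AE (dC k) Tsym (dC (T k)).
have Apos h : perp e h -> 0 <= rdot (A h) h.
  by move=> /He; rewrite AE -nm_sqr; lra.
have Afe : perp e (A f).
  move=> x xe; rewrite AE Tsym fe// fTe ?map_f//; lra.
have AAf : rdot (A (A f)) (A f) <= M * nm (A f) ^+ 2.
  apply: (le_trans (rdot_le _ _)); rewrite expr2 mulrA ler_wpM2r ?nm_ge0//.
  rewrite {1}/A; apply: (le_trans (nmB _ _)); rewrite nmZ ger0_norm; last lra.
  by have := T1 (A f); have := nm_ge0 (A f); rewrite /M; nra.
have cs : nm (A f) ^+ 2 * nm (A f) ^+ 2 <= rdot (A f) f * (M * nm (A f) ^+ 2).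
  apply: le_trans (_ : rdot (A f) f * rdot (A (A f)) (A f) <= _); last first.
    by rewrite ler_wpM2l// Apos.
  rewrite nm_sqr -expr2; apply: discriminant_le; rewrite ?Apos// => r.
  have /Apos : perp e (f + r%:C *: A f).
    by move=> x xe; rewrite dDl dZl fe// Afe// mulr0 addr0.
  rewrite Alin dDl 2!rdotDr !dZl !rdotZr [rdot (A (A f)) f]Asym.
  by congr (0 <= _); ring.
have AfM : nm (A f) ^+ 2 <= M * rdot (A f) f.
  have [z|z] := eqVneq (nm (A f)) 0.
    by rewrite z expr0n/= mulr_ge0 ?Apos// ltW.
  have z0 : 0 < nm (A f) ^+ 2 by rewrite exprn_gt0// lt_def z nm_ge0.
  by rewrite -(ler_pM2r z0); apply: (le_trans cs); rewrite mulrCA mulrA lexx.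
have low : d / 2 * nm f <= nm (A f).
  have := nmB (eps%:C *: f) (A f); rewrite nmZ ger0_norm ?(ltW eps0)//.
  have -> : eps%:C *: f - A f = T f - s0%:C *: f.
    by rewrite /A rmorphD/= scalerDl opprB opprD addrC -addrA subrK.
  by have := sd _ fs; have := nm_ge0 f; nra.
have : (d / 2 * nm f) ^+ 2 <= M * rdot (A f) f.
  apply: le_trans AfM; rewrite ler_sqr ?nnegrE ?nm_ge0// mulr_ge0 ?nm_ge0//.
  by rewrite ltW// divr_gt0.
rewrite AE -nm_sqr exprMn => h.
have : 2 * g * nm f ^+ 2 <= (s0 + eps) * nm f ^+ 2 - rdot (T f) f.
  rewrite -(ler_pM2l M0); apply: le_trans h.
  rewrite le_eqVlt; apply/orP; left; apply/eqP; rewrite /g; field.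
  by rewrite gt_eqF.
have := sqr_ge0 (nm f); nra.
Qed.

(** * Self-adjoint operators *)

(** Equality with the adjoint taken for [rdot]; on graphs stable under ['i] this is the complex
    notion, by [op_adjoint_rdotP]. Linearity over the reals and closedness follow, as every adjoint
    has them. *)
Definition selfadjoint_graph (A : set (E * E)) : Prop :=
  forall q, A q <-> forall p, A p -> rdot p.2 q.1 = rdot p.1 q.2.

Section Selfadjoint.
Context (A : set (E * E)) (Asa : selfadjoint_graph A).
Context (A_ge0 : forall p, A p -> 0 <= rdot p.2 p.1).

Lemma selfadjoint_real_graph : real_graph A.
Proof.
split.
- by apply/Asa => p _; rewrite !rdot0r.
- move=> p q /Asa Ap /Asa Aq; apply/Asa => x Ax.
  by rewrite /= !rdotDr Ap// Aq.
- by move=> r p /Asa Ap; apply/Asa => x Ax; rewrite /= !rdotZr Ap.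
Qed.

Lemma selfadjoint_closed : closed A.
Proof.
move=> q /closure_nmP2 clq; apply/Asa => p Ap; apply/eqP/contraT => neq.
pose x := `|rdot p.2 q.1 - rdot p.1 q.2|.
have x0 : 0 < x by rewrite normr_gt0 subr_eq0.
pose c := 1 + (nm p.2 + nm p.1).
have c0 : 0 < c by rewrite ltr_wpDr// addr_ge0 ?nm_ge0.
have [|y Ay [y1 y2]] := clq (x / c); first by rewrite divr_gt0.
have : x <= nm p.2 * nm (q.1 - y.1) + nm p.1 * nm (q.2 - y.2).
  rewrite /x; have -> : rdot p.2 q.1 - rdot p.1 q.2 =
      rdot p.2 (q.1 - y.1) - rdot p.1 (q.2 - y.2).
    by have /Asa/(_ _ Ap) := Ay; rewrite !rdotBr => ->; ring.
  by apply: (le_trans (ler_normB _ _)); apply: lerD; exact: cauchy_schwarz.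
apply: contraTT => _; rewrite -ltNge.
apply: (@le_lt_trans _ _ (nm p.2 * (x / c) + nm p.1 * (x / c))).
  by apply: lerD; rewrite ler_wpM2l ?nm_ge0// ltW.
have e0 : 0 < x / c by rewrite divr_gt0.
have ec : x = x / c * c by rewrite divfK// gt_eqF.
by rewrite -mulrDl [ltRHS]ec mulrC ltr_pM2l// /c ltrDr.
Qed.

(** The range of [1 + A] is closed because [|f| <= |(1 + A) f|]. A vector [w] orthogonal to it
    satisfies [A w = - w] by self-adjointness, and nonnegativity forces [w = 0]. *)
Lemma resolvent_surjective g : exists f, A (f, g - f).
Proof.
have [A0 AD AZ] := selfadjoint_real_graph.
pose G := [set p | A (p.1, p.2 - p.1)].
have rG : real_graph G.
  split; first by rewrite /G/= subr0.
    by move=> p q Gp Gq; rewrite /G/= opprD addrACA; exact: AD Gp Gq.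
  by move=> r p Gp; rewrite /G/= -scalerBr; exact: AZ r _ Gp.
have clG : closed G.
  move=> p /closure_nmP2 clp; apply: selfadjoint_closed.
  apply/closure_nmP2 => e e0; have [|q Gq [q1 q2]] := clp (e / 2).
    by rewrite divr_gt0.
  exists (q.1, q.2 - q.1) => //=; split; first by lra.
  have -> : p.2 - p.1 - (q.2 - q.1) = (p.2 - q.2) - (p.1 - q.1).
    by rewrite !opprB addrACA [RHS]addrACA (addrC (- p.1)).
  by apply: (le_lt_trans (nmB _ _)); lra.
have clR : closed [set p.2 | p in G].
  apply: (@closed_range [::] _ 1) => // p Gp _; rewrite mul1r.
  have [->|p0] := eqVneq p.1 0; first by rewrite nm0 nm_ge0.
  rewrite -(ler_pM2r (nm_gt0 p0)) -expr2 nm_sqr.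
  apply: le_trans (rdot_le _ _).
  by have := A_ge0 Gp; rewrite rdotBl subr_ge0.
have rR : real_subspace [set p.2 | p in G].
  have [G0 GD GZ] := rG; split; first by exists (0, 0).
    by move=> _ _ [p Gp <-] [q Gq <-]; eexists; first exact: GD Gp Gq.
  by move=> r _ [p Gp <-]; eexists; first exact: GZ r _ Gp.
have [_ [q Gq <-] gq] := orthogonal_projection g rR clR.
have Aq : A (g - q.2, - (g - q.2)).
  apply/Asa => p Ap /=; rewrite rdotNr.
  have /gq : [set p.2 | p in G] (p.2 + p.1).
    by exists (p.1, p.2 + p.1) => //; rewrite /G/= addrK -surjective_pairing.
  by rewrite rdotDr !(dC (g - q.2)) => /eqP; rewrite addr_eq0 => /eqP.
have gq0 : g - q.2 = 0.
  apply: nm0_eq0; apply/eqP; rewrite -sqrf_eq0 nm_sqr eq_le rdot_ge0 andbT.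
  by have := A_ge0 Aq; rewrite /= rdotNl oppr_ge0.
by exists q.1; move/eqP: gq0; rewrite subr_eq0 => /eqP ->.
Qed.

Lemma resolvent_unique f g h : A (f, g - f) -> A (h, g - h) -> f = h.
Proof.
have [A0 AD AZ] := selfadjoint_real_graph => Af Ah.
have := AD _ _ Af (AZ (-1) _ Ah).
rewrite /= rmorphN1 !scaleN1r opprB.
have -> : g - f + (h - g) = - (f - h).
  by rewrite opprB addrC addrA subrK.
move=> /A_ge0/=; rewrite rdotNl oppr_ge0 => fh.
apply/eqP; rewrite -subr_eq0; apply/eqP/nm0_eq0/eqP.
by rewrite -sqrf_eq0 nm_sqr eq_le fh rdot_ge0.
Qed.

(* [1 / (1 + t)] being the spectral parameter of the resolvent
   [T = (1 + A)^-1], the hypothesis forces the infimum of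
   [s | <T f, f> <= s |f|^2 on a subspace of finite codimension]
   below [1 / (1 + l)]. *)
Lemma form_gt_below_ess_spectrum (l : R) :
  (forall t, t <= l -> ~ ess_spectrum A t%:C) ->
  exists2 c, l < c & exists e, forall p, A p -> perp e p.1 ->
    c * nm p.1 ^+ 2 <= rdot p.2 p.1.
Proof.
move=> noess; have [l0|l0] := ltP l 0.
  by exists 0 => //; exists [::] => p Ap _; rewrite mul0r A_ge0.
have [A0 AD AZ] := selfadjoint_real_graph.
have /choice[T AT] := resolvent_surjective.
have TA f h : A (f, h) -> T (f + h) = f.
  by move=> Afh; apply: (resolvent_unique (AT (f + h))); rewrite addrAC subrr add0r.
have Tlin : real_linear T.
  split=> [f g|r f]; [apply: (resolvent_unique (AT (f + g)))|
                      apply: (resolvent_unique (AT (r%:C *: f)))].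
    by rewrite opprD addrACA; exact: AD _ _ (AT f) (AT g).
  by rewrite -scalerBr; exact: AZ r _ (AT f).
have Tsym : symmetric T.
  move=> f g; have /Asa/(_ _ (AT f)) := AT g.
  by rewrite /= rdotBl rdotBr; lra.
have T_le f : nm (T f) ^+ 2 <= rdot (T f) f.
  by have := A_ge0 (AT f); rewrite /= rdotBl nm_sqr dC subr_ge0.
have T1 f : nm (T f) <= nm f.
  have [->|Tf0] := eqVneq (T f) 0; first by rewrite nm0 nm_ge0.
  rewrite -(ler_pM2l (nm_gt0 Tf0)) -expr2.
  by apply: (le_trans (T_le f)); exact: rdot_le.
have T0 f : 0 <= rdot (T f) f by apply: le_trans (T_le f); rewrite sqr_ge0.
pose S := [set s : R | 0 < s /\ exists e, forall f, perp e f ->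
   rdot (T f) f <= s * nm f ^+ 2].
have S1 : S 1.
  split=> //; exists [::] => f _; rewrite mul1r expr2.
  apply: (le_trans (rdot_le _ _)); rewrite ler_wpM2r ?nm_ge0//.
have infS : has_inf S by split; [exists 1|exists 0 => s [/ltW]].
have [[s [[s0 [e He]] sl]]|nos] := pselect (exists s, S s /\ s < (1 + l)^-1).
  exists (s^-1 - 1).
    by rewrite ltrBrDl -[ltLHS]invrK ltf_pV2 ?posrE ?invr_gt0//; lra.
  exists e => -[f h] /= Afh fe.
  have Tg := TA _ _ Afh; move: Tg; move gE : (f + h) => g Tg.
  (* Cauchy-Schwarz for the form of [T] at [g] and [f = T g]. The constraint [perp e] is thereby
     used on [f], the vector in the domain of [A], and not on [g]. *)
  have cs : nm f ^+ 2 * nm f ^+ 2 <= rdot f g * (s * nm f ^+ 2).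
    apply: le_trans (_ : rdot (T g) g * rdot (T f) f <= _); last first.
      by rewrite Tg ler_wpM2l ?He// -{1}Tg T0.
    rewrite -expr2 -[X in X ^+ 2](_ : rdot (T g) f = _); last by rewrite Tg nm_sqr.
    apply: discriminant_le => // r.
    have := T0 (g + r%:C *: f); have [TD TZ] := Tlin.
    rewrite TD TZ dDl 2!rdotDr !dZl !rdotZr (Tsym f g) (dC f (T g)).
    by congr (0 <= _); ring.
  have [->|f0] := eqVneq f 0; first by rewrite nm0 expr0n/= mulr0 rdot0r.
  have nf2 : 0 < nm f ^+ 2 by rewrite exprn_gt0// nm_gt0.
  have : nm f ^+ 2 <= s * rdot f g.
    by rewrite -(ler_pM2r nf2); apply: (le_trans cs); rewrite mulrCA mulrA.
  rewrite -gE rdotDr -nm_sqr (dC h) mulrC => le_s.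
  have : s^-1 * nm f ^+ 2 <= nm f ^+ 2 + rdot f h.
    by rewrite mulrC ler_pdivrMr.
  by lra.
exfalso; move s0E : (inf S) => s0.
have l1 : 0 < (1 + l)^-1 by rewrite invr_gt0; lra.
have s0l : (1 + l)^-1 <= s0.
  rewrite -s0E; apply: lb_le_inf; first by exists 1.
  by move=> s Ss; rewrite leNgt; apply/negP => sl; apply: nos; exists s.
have s00 : 0 < s0 by apply: lt_le_trans s0l.
pose t := s0^-1 - 1.
have tl : t <= l.
  by rewrite /t lerBlDl -[leRHS]invrK lef_pV2 ?posrE.
have /not_orP[/contrapT clR /finite_dim_perp[k Hk]] := noess _ tl.
pose B f := T f - s0%:C *: f.
have Blin : real_linear B.
  have [TD TZ] := Tlin; split=> [f g|r f]; rewrite /B.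
    by rewrite TD scalerDr opprD addrACA.
  by rewrite TZ scalerBr !scalerA mulrC.
have Bsym : symmetric B.
  by move=> f g; rewrite /B rdotBl rdotBr dZl rdotZr Tsym.
have s0n : (s0%:C : R[i]) != 0 by rewrite eq_complex/= eqxx andbT gt_eqF.
have tE : t%:C = (s0%:C)^-1 - 1 :> R[i] by rewrite /t rmorphB/= fmorphV.
(* As [A T = 1 - T], this reads [(A - t) T = - s0^-1 B]: so [B] and [A - t] have the same range, and
   the kernel of [B] lies in that of [A - t]. *)
have BA g : g - T g - t%:C *: T g = - (s0%:C)^-1 *: B g.
  rewrite /B tE scalerBl scale1r scaleNr scalerBr scalerA mulVf// scale1r.
  by rewrite !opprB addrA subrK.
have rgB : range B = op_range A t%:C.
  have BZ r f : B (r%:C *: f) = r%:C *: B f by case: Blin.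
  apply/seteqP; split=> [_ [g _ <-]|_ [[f h] Afh <-]] /=.
    exists (T ((- s0)%:C *: g), (- s0)%:C *: g - T ((- s0)%:C *: g)).
      exact: AT.
    by rewrite /= BA BZ scalerA rmorphN mulrNN mulVf// scale1r.
  exists ((- s0^-1)%:C *: (f + h)) => //.
  have := BA (f + h); rewrite (TA _ _ Afh) [f + h - f]addrAC subrr add0r => ->.
  by rewrite BZ rmorphN/= fmorphV.
have [d d0 Hd] : exists2 d : R, 0 < d & forall f, perp k f -> d * nm f <= nm (B f).
  apply: symmetric_bounded_below => //; first by rewrite rgB.
  move=> f fk w /eqP; rewrite subr_eq0 => /eqP Tw; apply: Hk => //.
  have := AZ s0^-1 _ (AT w).
  rewrite /op_ker /= Tw tE fmorphV scalerBr scalerA mulVf// scale1r.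
  by rewrite scalerBl scale1r.
have approx eps : 0 < eps -> exists e, forall f, perp e f ->
    rdot (T f) f <= (s0 + eps) * nm f ^+ 2.
  move=> /inf_adherent/(_ infS)[s [_ [e He]]]; rewrite s0E => /ltW ss0.
  exists e => f /He h.
  by apply: (le_trans h); rewrite ler_wpM2r ?sqr_ge0.
have [s1 s10 [e He]] := lower_top_form Tlin Tsym T1 (ltW s00) d0 Hd approx.
(* [S] contains only positive numbers, so that [s^-1 - 1] makes sense as a bound, and [s1] may fail
   to be positive; [s0 / 2] is positive and still below [s0]. *)
have : s0 <= Num.max s1 (s0 / 2).
  rewrite -[leLHS]s0E; apply: ge_inf; first by case: infS.
  split; first by rewrite lt_max divr_gt0 ?orbT.
  exists e => f /He h; apply: (le_trans h).
  by rewrite ler_wpM2r ?sqr_ge0// le_max lexx.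
by rewrite le_max; lra.
Qed.

(* A perturbation of a self-adjoint operator by a skew-symmetric one has the
   same real part of the quadratic form, which is all that is used of [G]. *)
Lemma ess_spectrum_re_ge (G : set (E * E)) (z : R[i]) :
  real_graph G -> closed G ->
  (forall p, G p -> exists2 h, A (p.1, h) & rdot p.2 p.1 = rdot h p.1) ->
  (forall t, t <= complex.Re z -> ~ ess_spectrum A t%:C) ->
  ~ ess_spectrum G z.
Proof.
move=> [G0 GD GZ] clG GA /form_gt_below_ess_spectrum[c zc [e He]].
have lb p : G p -> perp e p.1 ->
    (c - complex.Re z) * nm p.1 <= nm (p.2 - z *: p.1).
  move=> Gp pe; have [h Ah ph] := GA _ Gp.
  have [->|p0] := eqVneq p.1 0; first by rewrite nm0 mulr0 nm_ge0.
  rewrite -(ler_pM2r (nm_gt0 p0)); apply: le_trans (rdot_le _ _).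
  rewrite rdotBl rdotZ_diag ph -mulrA -expr2.
  by have := He _ Ah pe; rewrite -nm_sqr /=; lra.
have cz0 : 0 < c - complex.Re z by rewrite subr_gt0.
move=> [|inf].
  (* [Gz] is the graph of [G - z], so that [closed_range] applies with the inverse of the gap as
     constant. *)
  apply; pose Gz := [set p | G (p.1, p.2 + z *: p.1)].
  have -> : op_range G z = [set p.2 | p in Gz].
    apply/seteqP; split=> [_ [p Gp <-]|_ [p Gp <-]].
      exists (p.1, p.2 - z *: p.1) => //.
      by rewrite /Gz /= subrK -surjective_pairing.
    by exists (p.1, p.2 + z *: p.1) => //=; rewrite addrK.
  apply: (@closed_range e _ (c - complex.Re z)^-1).
  - split; first by rewrite /Gz/= scaler0 addr0.
      by move=> p q Gp Gq; rewrite /Gz/= scalerDr addrACA; exact: GD Gp Gq.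
    move=> r p Gp; rewrite /Gz/= scalerA mulrC -scalerA -scalerDr.
    exact: GZ r _ Gp.
  - move=> p /closure_nmP2 clp; apply: clG; apply/closure_nmP2 => x x0.
    pose k := 1 + complex.Re `|z|.
    have k1 : 1 <= k.
      by rewrite lerDl; have := normr_ge0 z; rewrite lecE => /andP[].
    have k0 : 0 < k by apply: lt_le_trans k1.
    have [|q Gq [q1 q2]] := clp (x / k); first by rewrite divr_gt0.
    have xk : x / k <= x by rewrite ler_pdivrMr// ler_peMr// ltW.
    exists (q.1, q.2 + z *: q.1) => //=; split; first exact: lt_le_trans xk.
    rewrite opprD addrACA -scalerBr; apply: (le_lt_trans (nmD _ _)).
    rewrite nmZc; apply: (@lt_le_trans _ _ (x / k + complex.Re `|z| * (x / k))).
      apply: ltr_leD => //; rewrite ler_wpM2l ?(ltW q1)//.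
      by move: k1; rewrite lerDl.
    by rewrite -{1}(mul1r (x / k)) -mulrDl -/k mulrC divfK// gt_eqF.
  - move=> p Gp pe; rewrite mulrC ler_pdivlMr// mulrC.
    by have := lb _ Gp pe; rewrite /= addrK.
(* With one kernel vector more than there are constraints, a nontrivial combination lies in
   [perp e], where [lb] makes it vanish, against independence. *)
have [v [vK vfree]] := inf (size e).+1.
have [r [[i ri] rv]] := perp_combination v (ltnSn (size e)).
set f := \sum_i _ in rv.
have Gf : G (f, z *: f).
  rewrite /f scaler_sumr; pose P p := G p.
  have : P (\sum_j (r j)%:C *: v j, \sum_j z *: ((r j)%:C *: v j)).
    elim/big_rec2: _ => [//|j x y _ Gxy].
    have := GD _ _ (GZ (r j) _ (vK j)) Gxy.
    by rewrite /= scalerA mulrC -scalerA.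
  by [].
have := lb _ Gf rv; rewrite /= subrr nm0 pmulr_rle0// => nf.
have f0 : f = 0 by apply: nm0_eq0; apply/eqP; rewrite eq_le nf nm_ge0.
have := vfree _ f0 i => /eqP; rewrite eq_complex/= eqxx andbT.
by move/eqP => ri0; rewrite ri0 eqxx in ri.
Qed.

End Selfadjoint.

(** * Closures and skew-symmetric perturbations *)

Lemma nm_i f : nm ('i *: f) = nm f.
Proof.
by rewrite /nm (rdotIl hE) scalerA -expr2 sqr_i scaleN1r rdotNr opprK.
Qed.

Lemma closure_i (A : set (E * E)) :
  (forall p, A p -> A ('i *: p.1, 'i *: p.2)) ->
  forall p, closure A p -> closure A ('i *: p.1, 'i *: p.2).
Proof.
move=> Ai p /closure_nmP2 clp; apply/closure_nmP2 => e /clp[q Aq [q1 q2]].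
exists ('i *: q.1, 'i *: q.2); first exact: Ai.
by rewrite /= -!scalerBr !nm_i.
Qed.

Lemma closure_form_ge0 (A : set (E * E)) :
  (forall p, A p -> 0 <= rdot p.2 p.1) ->
  forall p, closure A p -> 0 <= rdot p.2 p.1.
Proof.
move=> A0 p /closure_nmP2 clp; apply/ler_addgt0Pl => e e0; rewrite addrC.
(* [<q.2, q.1> - <p.2, p.1>] splits into [<q.2, q.1 - p.1> + <q.2 - p.2, p.1>], which is at most
   [c * d] once [d <= 1]. *)
pose c := 1 + nm p.1 + nm p.2.
have c1 : 1 <= c by have := nm_ge0 p.1; have := nm_ge0 p.2; rewrite /c; lra.
have c0 : 0 < c by apply: lt_le_trans c1.
pose d := Num.min 1 (e / c).
have d0 : 0 < d by rewrite lt_min ltr01 divr_gt0.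
have [q Aq [q1 q2]] := clp _ d0.
have d1 : d <= 1 by rewrite ge_min lexx.
have dc : d * c <= e by rewrite -ler_pdivlMr// ge_min lexx orbT.
have n2 : nm q.2 <= nm p.2 + d.
  have := nmB p.2 (p.2 - q.2); rewrite opprB addrC subrK; lra.
have := A0 _ Aq; have := rdot_le (q.2 - p.2) p.1; have := rdot_le q.2 (q.1 - p.1).
rewrite rdotBr rdotBl (nm_distC q.2) (nm_distC q.1) => h1 h2 h3.
have h4 : nm (p.2 - q.2) * nm p.1 <= d * nm p.1.
  by rewrite ler_wpM2r ?nm_ge0// ltW.
have h5 : nm q.2 * nm (p.1 - q.1) <= (nm p.2 + d) * d.
  by rewrite ler_pM ?nm_ge0// ltW.
have h6 : (nm p.2 + d) * d <= (nm p.2 + 1) * d.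
  by rewrite ler_wpM2r ?(ltW d0)// lerD2l.
move: dc; rewrite /c; lra.
Qed.

(** Since [K] is bounded, the shear sending [(f, h)] to [(f, h - K f)] is a homeomorphism of the
    product and commutes with closures. Thus the closure of [A + K] is the closure of [A] plus
    [K]. *)
Lemma closure_shift (K : E -> E) (C : R) (A : set (E * E)) :
  (forall f g, K (f - g) = K f - K g) -> (forall f, nm (K f) <= C * nm f) ->
  closure [set p | A (p.1, p.2 - K p.1)] =
  [set p | closure A (p.1, p.2 - K p.1)].
Proof.
move=> KB KC; pose c := 1 + `|C|.
have c1 : 1 <= c by rewrite lerDl.
have c0 : 0 < c by apply: lt_le_trans c1.
have bound e u v (f g : E) : nm (f - g) < e / c -> nm (u - v) < e / c ->
    nm (u - v - (K f - K g)) < e /\ nm (u - v + (K f - K g)) < e.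
  move=> fg uv; have : nm (K f - K g) <= `|C| * nm (f - g).
    rewrite -KB; apply: (le_trans (KC _)); rewrite ler_wpM2r ?nm_ge0//.
    exact: ler_norm.
  have : `|C| * nm (f - g) <= `|C| * (e / c) by rewrite ler_wpM2l// ltW.
  have := nmB (u - v) (K f - K g); have := nmD (u - v) (K f - K g).
  have : e = e / c + `|C| * (e / c).
    by rewrite -{1}(mul1r (e / c)) -mulrDl -/c mulrC divfK// gt_eqF.
  lra.
have ec e : 0 < e -> 0 < e / c by move=> e0; rewrite divr_gt0.
have ece e : 0 < e -> e / c <= e.
  by move=> e0; rewrite ler_pdivrMr// ler_peMr// ltW.
apply/seteqP; split=> p /closure_nmP2 clp; apply/closure_nmP2 => e e0.
  have [q Aq [q1 q2]] := clp _ (ec _ e0).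
  exists (q.1, q.2 - K q.1) => //=; split; first exact: lt_le_trans (ece _ e0).
  have -> : p.2 - K p.1 - (q.2 - K q.1) = p.2 - q.2 - (K p.1 - K q.1).
    by rewrite !opprB addrACA [RHS]addrACA (addrC (- K p.1)).
  by have [] := bound _ _ _ _ _ q1 q2.
have [q Aq /= [q1 q2]] := clp _ (ec _ e0).
exists (q.1, q.2 + K q.1) => /=; first by rewrite addrK -surjective_pairing.
split; first exact: lt_le_trans (ece _ e0).
have -> : p.2 - (q.2 + K q.1) = p.2 - K p.1 - q.2 + (K p.1 - K q.1).
  by rewrite addrACA addrA subrK opprD addrA.
by have [] := bound _ _ _ _ _ q1 q2.
Qed.

(** An everywhere defined skew [K] changes sign under the adjoint: [G] is [A + K], so [G'] is
    [A - K] on the same domain and the perturbations cancel. Density of the domain makes [A]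
    single-valued, which identifies [u - K f] with [v + K f]. *)
Lemma half_sum_skew (A G G' : set (E * E)) (K : E -> E) :
  selfadjoint_graph A ->
  (forall w, (forall p, A p -> rdot p.1 w = 0) -> w = 0) ->
  (forall f g, rdot (K f) g = - rdot f (K g)) ->
  (forall p, G p <-> A (p.1, p.2 - K p.1)) ->
  (forall q, G' q <-> forall p, G p -> rdot p.2 q.1 = rdot p.1 q.2) ->
  half_sum G G' = A.
Proof.
move=> Asa dense Kskew GA G'P.
have [_ AD AZ] := selfadjoint_real_graph Asa.
have uniqA f u v : A (f, u) -> A (f, v) -> u = v.
  move=> Au Av; apply/eqP; rewrite -subr_eq0; apply/eqP/dense => p Ap.
  have := AD _ _ Au (AZ (-1) _ Av); rewrite /= rmorphN1 !scaleN1r subrr.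
  by move=> /Asa/(_ _ Ap)/=; rewrite rdot0r.
have G'A q : G' q <-> A (q.1, q.2 + K q.1).
  split=> [/G'P h|Aq].
    apply/Asa => p Ap /=; have := h (p.1, p.2 + K p.1).
    rewrite /= dDl Kskew rdotDr => <-; first by rewrite subrK.
    by apply/GA; rewrite /= addrK -surjective_pairing.
  apply/G'P => p /GA Ap; have /Asa/(_ _ Ap)/= := Aq.
  by rewrite rdotBl rdotDr Kskew; lra.
have half2 (f : E) : 2^-1 *: (f + f) = f.
  by rewrite -mulr2n -[f *+ 2]scaler_nat scalerA mulVf ?scale1r// pnatr_eq0.
apply/seteqP; split=> [[f h] /= [u [v [/GA/= Au /G'A/= Av ->]]]|[f h] Afh].
  rewrite (_ : u + v = (u - K f) + (v + K f)); last first.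
    by rewrite addrACA addNr addr0.
  by rewrite (uniqA _ _ _ Av Au) half2.
exists (h + K f), (h - K f); split; [by apply/GA; rewrite /= addrK| |].
  by apply/G'A; rewrite /= subrK.
by rewrite /= addrACA addrN addr0 half2.
Qed.

(** The kernel of [phi] is a closed subspace containing [B]; the projection error of any [f] onto it
    is orthogonal to [B], hence zero. It reduces skewness of the kernel operator to delta
    functions. *)
Lemma bounded_functional_eq0 (B : set E) (phi : E -> R) (C : R) :
  (forall w, (forall e, B e -> rdot e w = 0) -> w = 0) ->
  (forall f g, phi (f + g) = phi f + phi g) ->
  (forall r f, phi (r%:C *: f) = r * phi f) ->
  (forall f, `|phi f| <= C * nm f) ->
  (forall e, B e -> phi e = 0) -> forall f, phi f = 0.
Proof.
move=> dense phiD phiZ phiC phiB f; pose X := [set f | phi f = 0].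
have sX : real_subspace X.
  split.
  - by rewrite /X/= -(scale0r (0 : E)) -(rmorph0 (real_complex R)) phiZ mul0r.
  - by move=> g h /= g0 h0; rewrite /X/= phiD g0 h0 addr0.
  - by move=> r g /= g0; rewrite /X/= phiZ g0 mulr0.
have clX : closed X.
  move=> g /closure_nmP clg; apply/eqP/contraT => g0.
  have n0 : 0 < `|phi g| by rewrite normr_gt0.
  have c0 : 0 < 1 + `|C| by rewrite ltr_wpDr.
  have [|h /= h0 gh] := clg (`|phi g| / (1 + `|C|)); first by rewrite divr_gt0.
  have phiBE : phi (g - h) = phi g.
    rewrite -scaleN1r -(rmorphN1 (real_complex R)) phiD phiZ [phi h]h0.
    by rewrite mulr0 addr0.
  have := phiC (g - h); rewrite phiBE.
  have : C * nm (g - h) <= (1 + `|C|) * nm (g - h).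
    by rewrite ler_wpM2r ?nm_ge0//; have := ler_norm C; lra.
  by move: gh; rewrite ltr_pdivlMr//; lra.
have [p Xp fp] := orthogonal_projection f sX clX.
have fp0 : f - p = 0 by apply: dense => e Be; rewrite dC fp// /X/= phiB.
by rewrite -(subrK p f) fp0 add0r.
Qed.

End Hilbert.
(** * The Hilbert space of square-summable functions *)

Section RealSum.
Context {R : realType} {V : choiceType}.
Implicit Types (F G : V -> R) (a : V -> \bar R).

Definition rsummable F : Prop := summable [set: V] (EFin \o F).

Lemma rsummable_le F G : (forall x, `|F x| <= G x) -> rsummable G -> rsummable F.
Proof.
move=> FG; apply: le_lt_trans; apply: le_esum => x _ /=.
by rewrite lee_fin (le_trans (FG x))// ler_norm.
Qed.

Lemma rsummableD F G : rsummable F -> rsummable G -> rsummable (F \+ G).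
Proof. exact: summableD. Qed.

Lemma esumZ (r : R) a : 0 <= r -> (forall x, 0 <= a x)%E ->
  (\esum_(x in [set: V]) (r%:E * a x) = r%:E * \esum_(x in [set: V]) a x)%E.
Proof.
move=> r0 a0; rewrite /esum -ereal_supZl//; last first.
  by apply/set0P; exists (\sum_(x \in set0) a x)%E; exists set0.
congr ereal_sup; rewrite image_comp; apply: eq_imagel => A _ /=.
by rewrite ge0_mule_fsumr.
Qed.

Lemma rsummable_ge0 F : rsummable F -> (forall x, 0 <= F x) ->
  (\esum_(x in [set: V]) (F x)%:E)%E \is a fin_num.
Proof.
move=> sF F0; rewrite (@eq_esum _ _ _ _ (abse \o (EFin \o F))) -?summableE//.
by move=> x _ /=; rewrite ger0_norm.
Qed.

(** Taking positive parts is not additive; any summable nonnegative decomposition gives the same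
    value, and such decompositions can be added and scaled. *)
Lemma real_sumE F (a b : V -> R) : rsummable a -> rsummable b ->
  (forall x, 0 <= a x) -> (forall x, 0 <= b x) -> (forall x, F x = a x - b x) ->
  real_sum F = fine (\esum_(x in [set: V]) (a x)%:E) -
               fine (\esum_(x in [set: V]) (b x)%:E).
Proof.
move=> sa sb a0 b0 Fab.
have FE : EFin \o F = ((EFin \o a) \- (EFin \o b))%E.
  by apply/funext => x /=; rewrite Fab.
have sF : summable [set: V] (EFin \o F) by rewrite FE; exact: summableB.
have := esumB sa sb (fun x _ => a0 x) (fun x _ => b0 x); rewrite -FE => e.
have fp : (\esum_(x in [set: V]) ((EFin \o F)^\+ x))%E \is a fin_num.
  have := summable_funepos sF; rewrite summableE; congr (_ \is a fin_num).
  by apply: eq_esum => x _; rewrite gee0_abs.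
have fn : (\esum_(x in [set: V]) ((EFin \o F)^\- x))%E \is a fin_num.
  have := summable_funeneg sF; rewrite summableE; congr (_ \is a fin_num).
  by apply: eq_esum => x _; rewrite gee0_abs.
by rewrite /real_sum -!fineB ?rsummable_ge0// e.
Qed.

Lemma posneg_part F : exists a b : V -> R, [/\ forall x, 0 <= a x,
  forall x, 0 <= b x, forall x, F x = a x - b x,
  forall x, F x = 0 -> a x = 0 /\ b x = 0 &
  rsummable F -> rsummable a /\ rsummable b].
Proof.
exists (fun x => Num.max (F x) 0), (fun x => Num.max (- F x) 0).
split=> [x|x|x|x ->|sF]; rewrite ?oppr0 ?maxxx// ?le_max ?lexx ?orbT//.
  by have [?|?] := leP 0 (F x); [rewrite max_r|rewrite max_l]; lra.
have sF' : rsummable (fun x => `|F x|).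
  by move: sF; apply: le_lt_trans; apply: le_esum => x _ /=; rewrite normr_id.
split; apply: rsummable_le sF' => x; rewrite ger0_norm ?le_max ?lexx ?orbT//.
  by rewrite ge_max ler_norm normr_ge0.
by rewrite ge_max normr_ge0 -normrN ler_norm.
Qed.

Lemma real_sumD F G : rsummable F -> rsummable G ->
  real_sum (F \+ G) = real_sum F + real_sum G.
Proof.
have [a [b [a0 b0 Fab _ sab]]] := posneg_part F.
have [c [d [c0 d0 Gcd _ scd]]] := posneg_part G.
move=> /sab[sa sb] /scd[sc sd].
rewrite (@real_sumE F a b)// (@real_sumE G c d)//.
rewrite (@real_sumE _ (a \+ c) (b \+ d)) => [|||x|x|x]; first last.
- by rewrite /= Fab Gcd; ring.
- by rewrite /= addr_ge0.
- by rewrite /= addr_ge0.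
- exact: rsummableD.
- exact: rsummableD.
have add (u v : V -> R) : rsummable u -> rsummable v -> (forall x, 0 <= u x) ->
    (forall x, 0 <= v x) -> fine (\esum_(x in [set: V]) ((u \+ v) x)%:E) =
    fine (\esum_(x in [set: V]) (u x)%:E) + fine (\esum_(x in [set: V]) (v x)%:E).
  move=> su sv u0 v0; rewrite -fineD ?rsummable_ge0// -esumD//.
  - by move=> x _; rewrite lee_fin.
  - by move=> x _; rewrite lee_fin.
by rewrite (add a c sa sc a0 c0) (add b d sb sd b0 d0) opprD addrACA.
Qed.

Lemma real_sumZ (r : R) F : rsummable F ->
  real_sum (fun x => r * F x) = r * real_sum F.
Proof.
have [a [b [a0 b0 Fab _ sab]]] := posneg_part F; move=> /sab[sa sb].
have sZ (s : R) (u : V -> R) : rsummable u -> 0 <= s -> (forall x, 0 <= u x) ->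
    rsummable (fun x => s * u x) /\
    fine (\esum_(x in [set: V]) (s * u x)%:E) =
    s * fine (\esum_(x in [set: V]) (u x)%:E).
  move=> su s0 u0.
  have e : (\esum_(x in [set: V]) (s * u x)%:E =
      s%:E * \esum_(x in [set: V]) (u x)%:E)%E.
    by rewrite -esumZ// => x; rewrite lee_fin.
  have fu := rsummable_ge0 su u0.
  split; last by rewrite e fineM.
  rewrite /rsummable /summable (@eq_esum _ _ _ _ (fun x => (s * u x)%:E)).
    by rewrite e ltey_eq fin_numM.
  by move=> x _ /=; rewrite ger0_norm// mulr_ge0.
rewrite (@real_sumE F a b)//.
have [r0|r0] := leP 0 r.
  have [sra ra] := sZ _ _ sa r0 a0; have [srb rb] := sZ _ _ sb r0 b0.
  rewrite (real_sumE sra srb) ?ra ?rb ?mulrBr// => x; rewrite ?mulr_ge0//.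
  by rewrite Fab mulrBr.
have r0' : 0 <= - r by rewrite oppr_ge0 ltW.
have [sra ra] := sZ _ _ sa r0' a0; have [srb rb] := sZ _ _ sb r0' b0.
rewrite (real_sumE srb sra) ?ra ?rb => [|x|x|x]; rewrite ?mulr_ge0//; first by ring.
by rewrite Fab; ring.
Qed.

Lemma rsummable_seq F (s : seq V) : (forall x, F x != 0 -> x \in s) ->
  rsummable F.
Proof.
move=> Fs; rewrite /rsummable /summable (esumID [set` s]) ?setTI//.
rewrite [X in (_ + X)%E]esum1 => [|x /= xs]; last first.
  by have [->|/Fs /xs//] := eqVneq (F x) 0; rewrite normr0.
by rewrite adde0 esum_fset//= fsumEFin// ltry.
Qed.

Lemma real_sum_seq F (s : seq V) : uniq s -> (forall x, F x != 0 -> x \in s) ->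
  real_sum F = \sum_(x <- s) F x.
Proof.
move=> us Fs; have [a [b [a0 b0 Fab F0 sab]]] := posneg_part F.
have [sa sb] := sab (rsummable_seq Fs).
have es (u : V -> R) : (forall x, 0 <= u x) -> (forall x, F x = 0 -> u x = 0) ->
    fine (\esum_(x in [set: V]) (u x)%:E) = \sum_(x <- s) u x.
  move=> u0 uF; rewrite (esumID [set` s]) ?setTI//; last first.
    by move=> x _; rewrite lee_fin.
  rewrite [X in (_ + X)%E]esum1 => [|x /= xs]; last first.
    by rewrite uF//; apply/eqP/contraT => /Fs /xs.
  rewrite adde0 esum_fset//= => [|x _]; last by rewrite lee_fin.
  by rewrite fsumEFin//= -fsbig_seq.
rewrite (real_sumE sa sb)// !es// => [|x /F0[]//|x /F0[]//].
by rewrite -sumrB; apply: eq_bigr.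
Qed.

End RealSum.

(** * Real inner product and completeness of [l2] *)

Section L2Hilbert.
Context {R : realType} {V : choiceType} (m : V -> {posnum R}).
Implicit Types (f g h : l2 m).

Definition l2_rdot f g : R := complex.Re (l2_dot f g).

Lemma l2_addE f g x : (f + g) x = f x + g x. Proof. by []. Qed.
Lemma l2_oppE f x : (- f) x = - f x. Proof. by []. Qed.
Lemma l2_scaleE (z : R[i]) f x : (z *: f) x = z * f x. Proof. by []. Qed.

Lemma normc_sqr (z : R[i]) :
  ComplexField.Normc.normc z ^+ 2 = complex.Re z ^+ 2 + complex.Im z ^+ 2.
Proof. by case: z => a b; rewrite sqr_sqrtr// addr_ge0 ?sqr_ge0. Qed.

Lemma l2_rdotE f g : l2_rdot f g = real_sum (fun x => (m x)%:num *
  (complex.Re (f x) * complex.Re (g x) + complex.Im (f x) * complex.Im (g x))).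
Proof.
congr real_sum; apply/funext => x.
by case: (f x) => a b; case: (g x) => c d /=; ring.
Qed.

Lemma l2_rsummable f : rsummable (fun x => (m x)%:num *
  (complex.Re (f x) ^+ 2 + complex.Im (f x) ^+ 2)).
Proof.
have := valP f; rewrite inE /=; apply: le_lt_trans; apply: le_esum => x _ /=.
by rewrite lee_fin normc_sqr ger0_norm// mulr_ge0// addr_ge0 ?sqr_ge0.
Qed.

Lemma l2_rsummable_dot f g : rsummable (fun x => (m x)%:num *
  (complex.Re (f x) * complex.Re (g x) + complex.Im (f x) * complex.Im (g x))).
Proof.
apply: rsummable_le (rsummableD (l2_rsummable f) (l2_rsummable g)) => x /=.
rewrite normrM ger0_norm// -mulrDr ler_wpM2l//.
move: (f x) (g x) => [a b] [c d] /=.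
have := sqr_ge0 (a - c); have := sqr_ge0 (a + c).
have := sqr_ge0 (b - d); have := sqr_ge0 (b + d).
have := sqr_ge0 a; have := sqr_ge0 b; have := sqr_ge0 c; have := sqr_ge0 d.
by rewrite ler_norml; lra.
Qed.

Lemma l2_dotIm f g : complex.Im (l2_dot f g) = l2_rdot f ('i *: g).
Proof.
rewrite l2_rdotE; congr real_sum; apply/funext => x; rewrite l2_scaleE.
by case: (f x) => a b; case: (g x) => c d /=; ring.
Qed.

Lemma l2_sqnormE f : (l2_rdot f f)%:E = l2_sqnorm m f.
Proof.
have := l2_dotE f; rewrite [`|f|]/(l2_norm f) /l2_norm -rmorphXn/=.
rewrite sqr_sqrtr ?fine_ge0 ?l2_sqnorm_ge0// => e.
by rewrite /l2_rdot e /= fineK ?l2_sqnorm_fin.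
Qed.

Lemma l2_rdotDl f g h : l2_rdot (f + g) h = l2_rdot f h + l2_rdot g h.
Proof.
rewrite !l2_rdotE -real_sumD; [|exact: l2_rsummable_dot..].
congr real_sum; apply/funext => x; rewrite l2_addE /=.
by case: (f x) => a b; case: (g x) => c d /=; ring.
Qed.

Lemma l2_rdotZl (r : R) f g : l2_rdot (r%:C *: f) g = r * l2_rdot f g.
Proof.
rewrite !l2_rdotE -real_sumZ; last exact: l2_rsummable_dot.
congr real_sum; apply/funext => x; rewrite l2_scaleE /=.
by case: (f x) => a b /=; ring.
Qed.

Lemma l2_rdotIl f g : l2_rdot ('i *: f) g = - l2_rdot f ('i *: g).
Proof.
rewrite -mulN1r !l2_rdotE -real_sumZ; last exact: l2_rsummable_dot.
congr real_sum; apply/funext => x; rewrite !l2_scaleE /=.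
by case: (f x) => a b; case: (g x) => c d /=; ring.
Qed.

Lemma l2_rdotC f g : l2_rdot f g = l2_rdot g f.
Proof. by rewrite !l2_rdotE; congr real_sum; apply/funext => x; ring. Qed.

Lemma l2_sum_le f (s : seq V) : uniq s ->
  \sum_(x <- s) (m x)%:num * (complex.Re (f x) ^+ 2 + complex.Im (f x) ^+ 2)
  <= l2_rdot f f.
Proof.
move=> us; rewrite -lee_fin l2_sqnormE; apply: esum_ge; exists [set` s].
  by split.
rewrite fsumEFin//= lee_fin -fsbig_seq//.
by apply: ler_sum => x _; rewrite normc_sqr.
Qed.

Lemma l2_sqnorm_le (f : V -> R[i]^o) (C : R) :
  (forall s : seq V, uniq s ->
    \sum_(x <- s) (m x)%:num * (complex.Re (f x) ^+ 2 + complex.Im (f x) ^+ 2)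
    <= C) ->
  (l2_sqnorm m f <= C%:E)%E.
Proof.
move=> fC; apply: ge_ereal_sup => _ [A [finA _] <-].
rewrite fsumEFin//= lee_fin fsbig_finite//=.
apply: le_trans _ (fC (finmap.enum_fset (fset_set A)) (finmap.fset_uniq _)).
by apply: ler_sum => x _; rewrite normc_sqr.
Qed.

Lemma real_seq_complete (a : nat -> R) :
  (forall e, 0 < e -> exists N, forall i j, (N <= i)%N -> (N <= j)%N ->
     `|a i - a j| < e) ->
  exists l, forall e, 0 < e -> exists N, forall i, (N <= i)%N -> `|a i - l| < e.
Proof.
move=> ca; have /cauchy_cvg/cvg_ex[l al] : cauchy (a @ \oo).
  apply: cauchy_exP => e /ca[N HN]; exists (a N); exists N => // i Ni.
  by rewrite /= /ball/= HN.
exists l => e e0; have /cvgrPdist_lt/(_ _ e0)[N _ HN] := al.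
by exists N => i /HN; rewrite distrC.
Qed.

Lemma l2_pointwise_le f x :
  (m x)%:num * (complex.Re (f x) ^+ 2 + complex.Im (f x) ^+ 2) <= l2_rdot f f.
Proof. by have := @l2_sum_le f [:: x] isT; rewrite big_seq1. Qed.

(** The limit is taken pointwise, in real and imaginary parts; membership and convergence are read
    off finite partial sums, in the manner of Fatou's lemma. *)
Lemma l2_complete (u : nat -> l2 m) :
  (forall e : R, 0 < e -> exists N, forall i j, (N <= i)%N -> (N <= j)%N ->
     l2_rdot (u i - u j) (u i - u j) < e) ->
  exists l, forall e : R, 0 < e -> exists N, forall i, (N <= i)%N ->
     l2_rdot (u i - l) (u i - l) < e.
Proof.
move=> cu.
have cpt x : forall e, 0 < e -> exists N, forall i j, (N <= i)%N -> (N <= j)%N ->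
    `|complex.Re (u i x) - complex.Re (u j x)| < e /\
    `|complex.Im (u i x) - complex.Im (u j x)| < e.
  move=> e e0; have [|N HN] := cu ((m x)%:num * e ^+ 2).
    by rewrite mulr_gt0// exprn_gt0.
  exists N => i j Ni Nj.
  have := le_lt_trans (l2_pointwise_le (u i - u j) x) (HN i j Ni Nj).
  rewrite ltr_pM2l// l2_addE l2_oppE.
  move: (u i x) (u j x) => [a b] [c d] /= abcd.
  have := sqr_ge0 (a - c); have := sqr_ge0 (b - d).
  by split; rewrite -ltr_sqr ?nnegrE ?(ltW e0)// real_normK ?num_real//; lra.
have /choice[p Hp] : forall x, exists l, forall e, 0 < e -> exists N, forall i,
    (N <= i)%N -> `|complex.Re (u i x) - l| < e.
  move=> x; apply: real_seq_complete => e /(cpt x)[N HN]; exists N => i j Ni Nj.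
  by have [] := HN i j Ni Nj.
have /choice[q Hq] : forall x, exists l, forall e, 0 < e -> exists N, forall i,
    (N <= i)%N -> `|complex.Im (u i x) - l| < e.
  move=> x; apply: real_seq_complete => e /(cpt x)[N HN]; exists N => i j Ni Nj.
  by have [] := HN i j Ni Nj.
pose l : V -> R[i]^o := fun x => p x +i* q x.
have near (s : seq V) e : 0 < e -> exists N, forall i, (N <= i)%N ->
    \sum_(x <- s) (m x)%:num * (complex.Re (u i x - l x) ^+ 2 +
                                complex.Im (u i x - l x) ^+ 2) < e.
  elim: s e => [|x s IH] e e0; first by exists 0%N => i _; rewrite big_nil.
  have e2 : 0 < e / 2 by rewrite divr_gt0.
  have [N HN] := IH _ e2.
  pose c := Num.sqrt (e / 2 / (2 * (m x)%:num)).
  have c0 : 0 < c by rewrite sqrtr_gt0 divr_gt0// mulr_gt0.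
  have c2 : (m x)%:num * (c ^+ 2 + c ^+ 2) = e / 2.
    by rewrite sqr_sqrtr; [field|rewrite divr_ge0 ?ltW// mulr_gt0].
  have [N1 HN1] := Hp x _ c0; have [N2 HN2] := Hq x _ c0.
  exists (maxn N (maxn N1 N2)) => i; rewrite !geq_max => /and3P[Ni N1i N2i].
  rewrite big_cons [ltRHS]splitr ltrD ?HN// -c2 ltr_pM2l//.
  have := HN1 _ N1i; have := HN2 _ N2i; rewrite /l.
  case: (u i x) => a b /= bq ap; apply: ltrD.
    by rewrite -real_normK ?num_real// ltr_sqr ?nnegrE ?(ltW c0).
  by rewrite -[ltLHS]real_normK ?num_real// ltr_sqr ?nnegrE ?(ltW c0).
(* [N] is independent of the finite set [s]; only the auxiliary index [j] depends on it. Splitting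
   [u i - l] at [u j] gives the bound [2 * (e / 4) + 2 * (e / 4)]. *)
have bound e : 0 < e -> exists N, forall i, (N <= i)%N ->
    (l2_sqnorm m (fun x => (u i x - l x)%R) <= e%:E)%E.
  move=> e0; have e4 : 0 < e / 4 by rewrite divr_gt0.
  have [N HN] := cu _ e4; exists N => i Ni; apply: l2_sqnorm_le => s us.
  have [N' HN'] := near s _ e4; pose j := maxn N N'.
  have ij := HN i j Ni (leq_maxl _ _); have jl := HN' j (leq_maxr _ _).
  have := l2_sum_le (u i - u j) us.
  apply: contraTT; rewrite -!ltNge => big.
  apply: lt_le_trans ij _; apply: ltW.
  set A := \sum_(x <- s) _ in jl; set B := \sum_(x <- s) _ in big.
  set D := \sum_(x <- s) _.
  suff : B <= 2 * D + 2 * A by lra.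
  rewrite /B /D /A !mulr_sumr -big_split; apply: ler_sum => x _.
  rewrite l2_addE l2_oppE.
  move: (u i x) (u j x) (l x) => [a b] [c d] [a' b'] /=.
  rewrite mulrCA [X in _ <= _ + X]mulrCA -mulrDr ler_wpM2l//.
  by have := sqr_ge0 (a - c - (c - a')); have := sqr_ge0 (b - d - (d - b')); lra.
have [N HN] := bound 1 ltr01.
have lP : l \in l2_pred m.
  have dP : (fun x => u N x - l x : R[i]^o) \in l2_pred m.
    by rewrite inE /=; apply: le_lt_trans (HN N (leqnn _)) _; rewrite ltry.
  pose d : l2 m := L2 dP.
  suff -> : l = l2_fun (u N - d) by exact: valP.
  by apply/funext => x; rewrite l2_addE l2_oppE /= opprB addrC subrK.
exists (L2 lP) => e e0; have [|N' HN'] := bound (e / 2); first by rewrite divr_gt0.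
exists N' => i /HN' iN; rewrite -lte_fin l2_sqnormE.
by apply: le_lt_trans iN _; rewrite lte_fin; lra.
Qed.

Lemma l2_hilbert : is_hilbert l2_rdot.
Proof.
split; [exact: l2_rdotC|exact: l2_rdotDl|exact: l2_rdotZl|exact: l2_rdotIl| |
        exact: l2_complete].
by move=> f; rewrite /l2_rdot l2_dotE [`|f|]/(l2_norm f) /l2_norm -rmorphXn.
Qed.

End L2Hilbert.

(** * Finite sums and delta functions *)

Section FiniteSums.
Context {V : choiceType}.

Lemma finite_set_uniq_seq (A : set V) : finite_set A ->
  exists s : seq V, uniq s /\ forall x, A x -> x \in s.
Proof.
move=> fA; exists (finmap.enum_fset (fset_set A)).
by split=> [|x Ax]; [exact: finmap.fset_uniq|rewrite in_fset_set// inE].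
Qed.

Lemma fsum_seq (M : nmodType) (F : V -> M) (s : seq V) : uniq s ->
  (forall x, F x != 0 -> x \in s) ->
  \sum_(x \in [set: V]) F x = \sum_(x <- s) F x.
Proof.
move=> us Fs; rewrite [RHS]fsbig_seq//; symmetry; apply: fsbig_widen => // x [_ xs].
by apply/eqP/contraT => /Fs.
Qed.

(** Finiteness of the support matters: a sum over [[set: V]] with infinite support is [0] by
    default. *)
Lemma ler_seq_fsum (R : realDomainType) (F : V -> R) (s : seq V) : uniq s ->
  (forall x, 0 <= F x) -> finite_set [set x | F x != 0] ->
  \sum_(x <- s) F x <= \sum_(x \in [set: V]) F x.
Proof.
move=> us F0 /finite_set_uniq_seq[t [ut Ft]].
rewrite (@fsum_seq _ _ (undup (s ++ t))) ?undup_uniq//; last first.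
  by move=> x /Ft xt; rewrite mem_undup mem_cat xt orbT.
rewrite [leRHS](perm_big (s ++ [seq x <- undup (s ++ t) | x \notin s])); last first.
  apply: uniq_perm; rewrite ?undup_uniq// ?cat_uniq ?us ?filter_uniq ?undup_uniq//.
    by rewrite andbT; apply/hasPn => x; rewrite mem_filter => /andP[].
  move=> x; rewrite !(mem_undup, mem_cat, mem_filter).
  by case: (x \in s).
by rewrite big_cat/= lerDl sumr_ge0.
Qed.

End FiniteSums.

Section Delta.
Context {R : realType} {V : choiceType} (m : V -> {posnum R}).
Implicit Types (f g : l2 m).

Lemma l2_finite_support (f : V -> R[i]^o) (s : seq V) :
  (forall x, f x != 0 -> x \in s) -> f \in l2_pred m.
Proof.
move=> fs; rewrite inE /=; apply: le_lt_trans (_ : _ <=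
  (\sum_(x <- undup s) (m x)%:num * (complex.Re (f x) ^+ 2 +
                                     complex.Im (f x) ^+ 2))%:E)%E _.
  apply: l2_sqnorm_le => t ut.
  pose F x := (m x)%:num * (complex.Re (f x) ^+ 2 + complex.Im (f x) ^+ 2).
  have Fs x : F x != 0 -> x \in s.
    rewrite /F; apply: contraNT => xs.
    have -> : f x = 0 by apply/eqP; apply: contraNT xs => /fs.
    by rewrite expr0n addr0 mulr0.
  rewrite -(@fsum_seq _ _ F (undup s)) ?undup_uniq//; last first.
    by move=> x /Fs; rewrite mem_undup.
  apply: ler_seq_fsum => // [x|].
    by rewrite mulr_ge0// addr_ge0 ?sqr_ge0.
  by apply: (@sub_finite_set _ _ [set` s]) => //; exact: finite_seq.
exact: ltry.
Qed.

Lemma l2_delta_subproof x : (fun y => (y == x)%:R : R[i]^o) \in l2_pred m.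
Proof.
apply: (@l2_finite_support _ [:: x]) => y; rewrite inE.
by case: (y == x) => //=; rewrite eqxx.
Qed.

Definition l2_delta x : l2 m := L2 (l2_delta_subproof x).

Lemma l2_rdot_seq f g (s : seq V) : uniq s -> (forall x, f x != 0 -> x \in s) ->
  l2_rdot f g = \sum_(x <- s) (m x)%:num *
   (complex.Re (f x) * complex.Re (g x) + complex.Im (f x) * complex.Im (g x)).
Proof.
move=> us fs; rewrite l2_rdotE (real_sum_seq us)// => x; apply: contraNT => xs.
have -> : f x = 0 by apply/eqP; apply: contraNT xs => /fs.
by rewrite !mul0r addr0 mulr0.
Qed.

Lemma l2_rdot_delta f x : l2_rdot (l2_delta x) f = (m x)%:num * complex.Re (f x).
Proof.
rewrite (@l2_rdot_seq _ _ [:: x])//; first last.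
  by move=> y /=; rewrite inE; case: (y == x) => //=; rewrite eqxx.
by rewrite big_seq1 /= eqxx /= mul1r mul0r addr0.
Qed.

Lemma l2_ext f g : (forall x, f x = g x) -> f = g.
Proof. by move=> fg; apply/val_inj/funext. Qed.

(** Real pairing with [l2_delta x] detects only the real part of [w x]; the multiple by ['i] detects
    the imaginary part. *)
Lemma l2_delta_dense (w : l2 m) :
  (forall e, [set l2_delta x | x in [set: V]] e \/
             [set 'i *: l2_delta x | x in [set: V]] e -> l2_rdot e w = 0) ->
  w = 0.
Proof.
move=> h; apply: l2_ext => x; rewrite [RHS](_ : _ = 0)//.
have hx : l2_rdot (l2_delta x) w = 0 by apply: h; left; exists x.
have hix : l2_rdot ('i *: l2_delta x) w = 0 by apply: h; right; exists x.
move: hx hix; rewrite l2_rdotIl !l2_rdot_delta l2_scaleE; case: (w x) => a b /=.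
move=> /eqP; rewrite mulf_eq0 gt_eqF//= => /eqP ->.
move=> /eqP; rewrite oppr_eq0 mulf_eq0 gt_eqF//= mul0r mul1r sub0r oppr_eq0.
by move=> /eqP ->.
Qed.

End Delta.
(** * Skew-symmetric kernels *)

Section Kernel.
Context {R : realType} {V : choiceType} (m : V -> {posnum R}).
Context (a : V -> V -> R) (M : R) (M0 : 0 <= M).
Context (aC : forall x y, a y x = - a x y).
Context (a_fin : forall x, finite_set [set y | a x y != 0]).
Context (a_le : forall x, \sum_(y \in [set: V]) `|a x y| <= M * (m x)%:num).
Implicit Types (f g : l2 m).

Lemma complex_sumE (s : seq V) (c : V -> R) (f : V -> R[i]) :
  \sum_(y <- s) (c y)%:C * f y = (\sum_(y <- s) c y * complex.Re (f y)) +i*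
                                 (\sum_(y <- s) c y * complex.Im (f y)).
Proof.
elim: s => [|x s IH]; rewrite ?big_nil// !big_cons IH.
by case: (f x) => u v /=; apply/eqP; rewrite eq_complex/=; apply/andP; split;
   apply/eqP; ring.
Qed.

Definition kernel_fun (f : V -> R[i]^o) (x : V) : R[i]^o :=
  (- (2 * (m x)%:num)^-1)%:C * \sum_(y \in [set: V]) (a x y)%:C * f y.

Lemma kernel_fun_seq (s : seq V) (f : V -> R[i]^o) x : uniq s ->
  (forall y, a x y != 0 -> y \in s) ->
  kernel_fun f x = (- (2 * (m x)%:num)^-1)%:C * \sum_(y <- s) (a x y)%:C * f y.
Proof.
move=> us sx; rewrite /kernel_fun (fsum_seq us)// => y.
apply: contraNT => /(contra (sx y)); rewrite negbK => /eqP ->.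
by rewrite mul0r.
Qed.

Lemma kernel_fun_seqE (s : seq V) (f : V -> R[i]^o) x : uniq s ->
  (forall y, a x y != 0 -> y \in s) ->
  kernel_fun f x =
  (- (2 * (m x)%:num)^-1 * \sum_(y <- s) a x y * complex.Re (f y)) +i*
  (- (2 * (m x)%:num)^-1 * \sum_(y <- s) a x y * complex.Im (f y)).
Proof.
move=> us sx; rewrite (kernel_fun_seq _ us)// complex_sumE /=.
by apply/eqP; rewrite eq_complex/=; apply/andP; split; apply/eqP; ring.
Qed.

(** Cauchy-Schwarz for the weights [|w y|]: the polynomial in [r] is the sum of
    [|w y| (1 + r |p y|)^2]. *)
Lemma sum_cauchy_schwarz (I : Type) (s : seq I) (w p : I -> R) :
  (\sum_(y <- s) w y * p y) ^+ 2 <=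
  (\sum_(y <- s) `|w y|) * \sum_(y <- s) `|w y| * p y ^+ 2.
Proof.
have -> : (\sum_(y <- s) w y * p y) ^+ 2 = `|\sum_(y <- s) w y * p y| ^+ 2.
  by rewrite real_normK ?num_real.
apply: (@le_trans _ _ ((\sum_(y <- s) `|w y| * `|p y|) ^+ 2)).
  rewrite ler_sqr ?nnegrE ?sumr_ge0//.
  by apply: (le_trans (ler_norm_sum _ _ _)); apply: ler_sum => y _; rewrite normrM.
apply: discriminant_le => [||r].
- by rewrite sumr_ge0.
- by rewrite sumr_ge0// => y _; rewrite mulr_ge0// sqr_ge0.
rewrite mulr_sumr mulr_sumr -!big_split sumr_ge0//= => y _.
have -> : `|w y| + 2 * r * (`|w y| * `|p y|) + r ^+ 2 * (`|w y| * p y ^+ 2) =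
    `|w y| * (1 + r * `|p y|) ^+ 2.
  by rewrite -(real_normK (num_real (p y))); ring.
by rewrite mulr_ge0// sqr_ge0.
Qed.

Let n2 (f : V -> R[i]^o) y : R := complex.Re (f y) ^+ 2 + complex.Im (f y) ^+ 2.

Let n2_ge0 f y : 0 <= n2 f y. Proof. by rewrite addr_ge0 ?sqr_ge0. Qed.

(** The row bound on [a] gives [m |K f|^2 <= (M / 4) sum_y |a x y| |f y|^2] at each [x]. After
    exchanging the sums, the column bound, which equals the row bound by skewness, gives the other
    factor [M]. *)
Lemma kernel_schur f (s : seq V) : uniq s ->
  \sum_(x <- s) (m x)%:num * n2 (kernel_fun f) x <= M ^+ 2 / 4 * l2_rdot f f.
Proof.
move=> us.
have /choice[t Ht] : forall x, exists t : seq V,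
    uniq t /\ forall y, a x y != 0 -> y \in t.
  by move=> x; exact: finite_set_uniq_seq (a_fin x).
have abs_fin x : finite_set [set y | `|a x y| != 0].
  by apply: sub_finite_set (a_fin x) => y /=; rewrite normr_eq0.
pose B := undup (flatten [seq t x | x <- s]).
have pt x : x \in s -> (m x)%:num * n2 (kernel_fun f) x <=
    M / 4 * \sum_(y <- B) `|a x y| * n2 f y.
  move=> xs; have Bx y : a x y != 0 -> y \in B.
    move=> axy; rewrite mem_undup; apply/flatten_mapP; exists x => //.
    by have [_ ->] := Ht x.
  have uB : uniq B by rewrite undup_uniq.
  rewrite /n2 (kernel_fun_seqE _ uB Bx) /=.
  have := sum_cauchy_schwarz B (a x) (fun y => complex.Re (f y)).
  have := sum_cauchy_schwarz B (a x) (fun y => complex.Im (f y)).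
  set P := \sum_(y <- B) a x y * _; set Q := \sum_(y <- B) a x y * _.
  set W := \sum_(y <- B) `|a x y|.
  set U := \sum_(y <- B) _; set Z := \sum_(y <- B) _.
  move=> hP hQ.
  have -> : \sum_(y <- B) `|a x y| * (complex.Re (f y) ^+ 2 + complex.Im (f y) ^+ 2)
      = U + Z.
    by rewrite /U /Z -big_split/=; apply: eq_bigr => y _; ring.
  have UZ0 : 0 <= U + Z.
    by rewrite addr_ge0 ?sumr_ge0// => y _; rewrite mulr_ge0// sqr_ge0.
  have WM : W <= M * (m x)%:num by apply: le_trans (a_le x); exact: ler_seq_fsum.
  have mx : 0 < (m x)%:num by [].
  move: ((m x)%:num) WM mx => mu WM mu0.
  have h1 : P ^+ 2 + Q ^+ 2 <= M * mu * (U + Z).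
    apply: le_trans (_ : W * (U + Z) <= _); last by rewrite ler_wpM2r.
    by rewrite mulrDr; lra.
  have -> : mu * ((- (2 * mu)^-1 * Q) ^+ 2 + (- (2 * mu)^-1 * P) ^+ 2) =
      (P ^+ 2 + Q ^+ 2) * (4 * mu)^-1 by field; rewrite gt_eqF.
  rewrite ler_pdivrMr ?mulr_gt0//; apply: le_trans h1 _.
  by rewrite le_eqVlt; apply/orP; left; apply/eqP; field.
apply: (@le_trans _ _ (\sum_(x <- s) M / 4 * \sum_(y <- B) `|a x y| * n2 f y)).
  by rewrite big_seq [leRHS]big_seq; exact: ler_sum.
have -> : M ^+ 2 / 4 * l2_rdot f f = M / 4 * (M * l2_rdot f f) by ring.
rewrite -mulr_sumr ler_wpM2l ?divr_ge0//.
rewrite exchange_big/=.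
apply: (@le_trans _ _ (\sum_(y <- B) M * ((m y)%:num * n2 f y))); last first.
  by rewrite -mulr_sumr ler_wpM2l// l2_sum_le// undup_uniq.
apply: ler_sum => y _; rewrite -mulr_suml mulrA ler_wpM2r//.
apply: le_trans (a_le y).
under eq_bigr do rewrite aC normrN.
exact: ler_seq_fsum.
Qed.

Lemma kernel_fun_l2 f : kernel_fun f \in l2_pred m.
Proof.
rewrite inE /=; apply: le_lt_trans (l2_sqnorm_le (@kernel_schur f)) _.
exact: ltry.
Qed.

Definition kernel_op f : l2 m := L2 (kernel_fun_l2 f).

Lemma kernel_opE f x : kernel_op f x = kernel_fun f x. Proof. by []. Qed.

Lemma kernel_op_le f : nm (@l2_rdot R V m) (kernel_op f) <=
  M / 2 * nm (@l2_rdot R V m) f.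
Proof.
rewrite -ler_sqr ?nnegrE ?mulr_ge0 ?divr_ge0 ?nm_ge0//.
rewrite exprMn !(nm_sqr (l2_hilbert m)) -lee_fin l2_sqnormE.
have -> : (M / 2) ^+ 2 = M ^+ 2 / 4 by field.
exact: l2_sqnorm_le (@kernel_schur f).
Qed.

Lemma kernel_opP (z : R[i]) f g :
  kernel_op (z *: f + g) = z *: kernel_op f + kernel_op g.
Proof.
apply: l2_ext => x; rewrite l2_addE l2_scaleE !kernel_opE.
have [s [us sx]] := finite_set_uniq_seq (a_fin x).
rewrite !(kernel_fun_seq _ us sx) [z * _]mulrCA -mulrDr; congr (_ * _).
rewrite mulr_sumr -big_split; apply: eq_bigr => y _.
by rewrite l2_addE l2_scaleE mulrDr mulrCA.
Qed.

Lemma kernel_op_delta x y :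
  kernel_op (l2_delta m x) y = (- (2 * (m y)%:num)^-1 * a y x)%:C.
Proof.
rewrite kernel_opE /kernel_fun (@fsum_seq _ _ _ [:: x])//.
  by rewrite big_seq1 /= eqxx mulr1 rmorphM.
by move=> z; rewrite inE /=; case: (z == x) => //; rewrite mulr0 eqxx.
Qed.

(** Both sides are bounded in [f], so delta functions suffice; there the weight [m] cancels the
    [1 / m] of the kernel and leaves the skew [a]. *)
Lemma kernel_op_skew f g :
  l2_rdot (kernel_op f) g = - l2_rdot f (kernel_op g).
Proof.
have hH := l2_hilbert m.
have KD u v : kernel_op (u + v) = kernel_op u + kernel_op v.
  by rewrite -[in LHS](scale1r u) kernel_opP scale1r.
have KZ z u : kernel_op (z *: u) = z *: kernel_op u.
  have K0 : kernel_op 0 = 0.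
    by have := kernel_opP (-1) 0 0; rewrite scaler0 addr0 scaleN1r addNr.
  by rewrite -[in LHS](addr0 (z *: u)) kernel_opP K0 addr0.
apply/eqP; rewrite -subr_eq0 opprK; apply/eqP; move: f.
have onb x h : l2_rdot (kernel_op (l2_delta m x)) h +
    l2_rdot (l2_delta m x) (kernel_op h) = 0.
  have [s [us sx]] := finite_set_uniq_seq (a_fin x).
  rewrite l2_rdot_delta kernel_opE (kernel_fun_seqE _ us sx) /=.
  rewrite (@l2_rdot_seq _ _ _ _ _ s us) => [|y]; last first.
    rewrite kernel_op_delta aC => yx; apply: sx; apply: contra yx => /eqP ->.
    by rewrite oppr0 mulr0.
  rewrite mulr_sumr mulr_sumr -big_split big1// => y _.
  rewrite kernel_op_delta /= aC; field.
  by rewrite !gt_eqF.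
apply: (@bounded_functional_eq0 _ _ _ hH
  (fun e => [set l2_delta m x | x in [set: V]] e \/
            [set 'i *: l2_delta m x | x in [set: V]] e)
  (fun f => l2_rdot (kernel_op f) g + l2_rdot f (kernel_op g))
  (M / 2 * nm (@l2_rdot R V m) g + nm (@l2_rdot R V m) (kernel_op g))).
- exact: l2_delta_dense.
- by move=> f h; rewrite KD !l2_rdotDl addrACA.
- by move=> r f; rewrite KZ !l2_rdotZl -mulrDr.
- move=> f; apply: (le_trans (ler_normD _ _)); rewrite mulrDl; apply: lerD.
    apply: (le_trans (cauchy_schwarz hH _ _)).
    by rewrite mulrAC ler_wpM2r ?nm_ge0// kernel_op_le.
  by rewrite mulrC; exact: cauchy_schwarz.
- move=> _ [[x _ <-]|[x _ <-]]; first exact: onb.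
  rewrite KZ !l2_rdotIl -KZ -opprD -oppr0; congr (- _).
  exact: onb.
Qed.

End Kernel.
(** * The graph Laplacian *)

(** Applying the real identity to ['i] times a pair of [A] recovers the imaginary part of the
    complex one. *)
Lemma op_adjoint_rdotP (R : realType) (V : countType) (m : V -> {posnum R})
    (A : set (l2 m * l2 m)) :
  (forall p, A p -> A ('i *: p.1, 'i *: p.2)) ->
  forall q, op_adjoint A q <->
    forall p, A p -> l2_rdot p.2 q.1 = l2_rdot p.1 q.2.
Proof.
move=> Ai q; split=> [h p /h|h p Ap]; first by rewrite /l2_rdot => ->.
apply/eqP; rewrite eq_complex !l2_dotIm; apply/andP; split; apply/eqP.
  exact: h.
by have := h _ (Ai _ Ap); rewrite /= !l2_rdotIl => /oppr_inj.
Qed.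

(** Doubling and exchanging [x] and [y] turns the sum into that of [c x y * (p x - p y) ^+ 2]. *)
Lemma symmetric_form_ge0 (R : realDomainType) (I : Type) (s : seq I)
    (c : I -> I -> R) (p : I -> R) :
  (forall x y, 0 <= c x y) -> (forall x y, c x y = c y x) ->
  0 <= \sum_(x <- s) \sum_(y <- s) c x y * (p x * (p x - p y)).
Proof.
move=> c0 cC; rewrite -(pmulrn_lge0 _ (ltn0Sn 1)) mulr2n.
rewrite {2}exchange_big -big_split sumr_ge0//= => x _.
rewrite -big_split sumr_ge0//= => y _; rewrite (cC y x).
have -> : c x y * (p x * (p x - p y)) + c x y * (p y * (p y - p x)) =
  c x y * (p x - p y) ^+ 2 by ring.
by rewrite mulr_ge0// sqr_ge0.
Qed.

Section Graph.
Context {R : realType} {V : countType} (E : rel V) (b : V -> V -> R).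
Context (m : V -> {posnum R}).
Context (wE : weighted_digraph E b) (lfE : locally_finite E).

Lemma weight_neq0 x y : b x y != 0 -> E x y.
Proof.
move=> bxy; apply/(weight_gt0 wE).
by rewrite lt_def bxy (weight_ge0 wE).
Qed.

Lemma neighbours x : exists s : seq V, uniq s /\
  forall y, (b x y != 0 -> y \in s) /\ (b y x != 0 -> y \in s).
Proof.
have [s [us sx]] := finite_set_uniq_seq (lfE x); exists s; split=> // y.
by split=> /weight_neq0 xy; apply: sx; rewrite /= xy ?orbT.
Qed.

Lemma laplacian_seq (c : V -> V -> R) (f : V -> R[i]) x (s : seq V) :
  uniq s -> (forall y, c x y != 0 -> y \in s) ->
  laplacian c m f x =
  ((m x)%:num)^-1%:C * \sum_(y <- s) (c x y)%:C * (f x - f y).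
Proof.
move=> us sx; rewrite /laplacian (fsum_seq us)// => y.
apply: contraNT => /(contra (sx y)); rewrite negbK => /eqP ->.
by rewrite mul0r.
Qed.

Let a x y := b x y - b y x.

Lemma skew_weight_finite x : finite_set [set y | a x y != 0].
Proof.
have [s [_ sx]] := neighbours x.
apply: (@sub_finite_set _ _ [set` s]); last exact: finite_seq.
move=> y /=; apply: contraNT => ys.
have [b1 b2] := sx y; rewrite /a.
have -> : b x y = 0 by apply/eqP; apply: contraNT ys.
have -> : b y x = 0 by apply/eqP; apply: contraNT ys.
by rewrite subrr.
Qed.

Context (beta : assumption_beta b).

Lemma laplacian_sub (f : V -> R[i]) x :
  laplacian b m f x - laplacian (fun x y => b y x) m f x =
  2 * kernel_fun m a f x.
Proof.
have [s [us sx]] := neighbours x.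
have s1 y : b x y != 0 -> y \in s by have [] := sx y.
have s2 y : b y x != 0 -> y \in s by have [] := sx y.
have s3 y : a x y != 0 -> y \in s.
  rewrite /a => axy; have [bxy|/s1//] := eqVneq (b x y) 0.
  by apply: s2; move: axy; rewrite bxy sub0r oppr_eq0.
rewrite (laplacian_seq _ us s1) (@laplacian_seq (fun x y => b y x) f x s us s2).
rewrite (kernel_fun_seq m f us s3) -mulrBr -sumrB.
under eq_bigr => y _ do rewrite -mulrBl -rmorphB/= -/(a x y) mulrBr.
rewrite sumrB -mulr_suml -(rmorph_sum (real_complex R)).
have -> : \sum_(y <- s) a x y = 0.
  have := beta x; rewrite (fsum_seq us s1) (@fsum_seq _ _ (b^~ x) s us s2).
  by rewrite sumrB => ->; rewrite subrr.
have mE : 2 * (- (2 * (m x)%:num)^-1)%:C = - ((m x)%:num)^-1%:C :> R[i].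
  rewrite -(rmorph_nat (real_complex R) 2) -rmorphM -rmorphN; congr (_%:C).
  by field; rewrite gt_eqF.
by rewrite rmorph0 mul0r sub0r mulrA mE mulrN mulNr.
Qed.

Let D := laplacian_op b m.
Let D' := laplacian_op (fun x y => b y x) m.
Let H := half_sum D D'.

(** On [C_c(V)] the difference of the two Laplacians is [2 K], so their half sum is [Delta - K].
    Membership of [Delta' f] in [l2] is inherited from [Delta f - 2 K f]. *)
Lemma half_sum_laplacian (K : l2 m -> l2 m) :
  (forall f x, K f x = kernel_fun m a f x) ->
  forall p, D p <-> H (p.1, p.2 - K p.1).
Proof.
move=> KE p.
have half u v : u - v = 2 *: K p.1 -> p.2 - K p.1 = 2^-1 *: (u + v) <-> p.2 = u.
  move=> uv; have -> : u + v = 2 *: (u - K p.1).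
    rewrite scalerBr -uv opprB scaler_nat mulr2n -addrA.
    by rewrite [u + (v - u)]addrC subrK.
  rewrite scalerA mulVf ?scale1r ?pnatr_eq0//.
  by split=> [/addIr|->].
split=> [Dp|[u [v [[fin Du] [_ D'v] /= pE]]]].
  have [fin Dx] := Dp.
  exists p.2, (p.2 - 2 *: K p.1); split.
  - by split.
  - split=> // x; rewrite l2_addE l2_oppE l2_scaleE Dx KE -laplacian_sub.
    by rewrite opprB addrC subrK.
  - by apply/half => //; rewrite opprB addrC subrK.
have uv : u - v = 2 *: K p.1.
  apply: l2_ext => x.
  by rewrite l2_addE l2_oppE l2_scaleE KE -laplacian_sub Du D'v.
have uE := (half u v uv).1 pE.
by split=> [|x]; [exact: fin|rewrite uE Du].
Qed.

(** Green's formula: the form is the energy for the symmetric weight [c] of the real part of [f]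
    plus that of its imaginary part. *)
Lemma half_sum_laplacian_ge0 p : H p -> 0 <= l2_rdot p.2 p.1.
Proof.
case: p => f h [u [v [/= [fin Du] [_ D'v] ->]]] {h}; rewrite l2_rdotC.
have /choice[t Ht] := neighbours.
have [s0 [_ Hs0]] := finite_set_uniq_seq fin.
(* With the neighbours of the support added, one finite set carries all nonzero terms of the inner
   sums. *)
pose s := undup (s0 ++ flatten [seq t x | x <- s0]).
have us : uniq s by rewrite undup_uniq.
have fs x : f x != 0 -> x \in s.
  by move=> /Hs0 xs; rewrite mem_undup mem_cat xs.
have ts x y : f x != 0 -> y \in t x -> y \in s.
  move=> /Hs0 xs yt; rewrite mem_undup mem_cat; apply/orP; right.
  by apply/flatten_mapP; exists x.
rewrite (l2_rdot_seq _ us fs).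
pose c x y := (b x y + b y x) / 2.
have cC x y : c x y = c y x by rewrite /c addrC.
have c0 x y : 0 <= c x y by rewrite divr_ge0// addr_ge0// (weight_ge0 wE).
pose q (p : V -> R) := \sum_(x <- s) \sum_(y <- s) c x y * (p x * (p x - p y)).
have -> : \sum_(x <- s) (m x)%:num *
    (complex.Re (f x) * complex.Re ((2^-1 *: (u + v)) x) +
     complex.Im (f x) * complex.Im ((2^-1 *: (u + v)) x)) =
    q (fun x => complex.Re (f x)) + q (fun x => complex.Im (f x)).
  rewrite /q -big_split; apply: eq_bigr => x _.
  have [->|fx] := eqVneq (f x) 0.
    by rewrite !mul0r addr0 mulr0 !big1/= ?addr0// => y _; rewrite mul0r mulr0.
  have s1 y : b x y != 0 -> y \in s.
    by move=> bxy; apply: (ts x) => //; case: (Ht x) => _ /(_ y)[->].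
  have s2 y : b y x != 0 -> y \in s.
    by move=> bxy; apply: (ts x) => //; case: (Ht x) => _ /(_ y)[_ ->].
  have -> : (2^-1 *: (u + v)) x =
     ((m x)%:num)^-1%:C * \sum_(y <- s) (c x y)%:C * (f x - f y).
    rewrite l2_scaleE l2_addE Du D'v (laplacian_seq _ us s1).
    rewrite (@laplacian_seq (fun x y => b y x) f x s us s2).
    rewrite -mulrDr -big_split mulrCA; congr (_ * _); rewrite mulr_sumr.
    apply: eq_bigr => y _; rewrite /= -mulrDl mulrA -rmorphD/=; congr (_ * _).
    by rewrite /c rmorphM fmorphV rmorph_nat mulrC.
  rewrite complex_sumE; set P := \sum_(y <- s) c x y * complex.Re _.
  set Q := \sum_(y <- s) c x y * complex.Im _.
  have -> : (m x)%:num * (complex.Re (f x) *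
       complex.Re (((m x)%:num)^-1%:C * (P +i* Q)) +
     complex.Im (f x) * complex.Im (((m x)%:num)^-1%:C * (P +i* Q))) =
     complex.Re (f x) * P + complex.Im (f x) * Q.
    by rewrite /=; field; rewrite gt_eqF.
  rewrite /P /Q !mulr_sumr; congr (_ + _); apply: eq_bigr => y _.
    by rewrite mulrCA; case: (f x) (f y) => ? ? [].
  by rewrite mulrCA; case: (f x) (f y) => ? ? [].
by rewrite addr_ge0// symmetric_form_ge0.
Qed.

(** Delta functions lie in the domain, which makes it dense; local finiteness keeps the image
    finitely supported. *)
Lemma laplacian_delta x : exists u, D (l2_delta m x, u).
Proof.
have [s [us sx]] := neighbours x.
have lapP : laplacian b m (l2_delta m x) \in l2_pred m.
  apply: (@l2_finite_support _ _ _ _ (x :: s)) => y; apply: contraNT.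
  rewrite inE negb_or => /andP[yx ys].
  have [t [ut ty]] := neighbours y.
  rewrite (@laplacian_seq _ _ _ t)//; last by move=> z; have [] := ty z.
  rewrite big1 ?mulr0// => z _ /=; rewrite (negPf yx).
  have [->|zx] := eqVneq z x; last by rewrite subrr mulr0.
  have -> : b y x = 0 by apply/eqP; apply: contraNT ys; have [] := sx y.
  by rewrite mul0r.
exists (L2 lapP); split=> //=.
apply: (@sub_finite_set _ _ [set` [:: x]]); last exact: finite_seq.
by move=> y /=; rewrite inE; case: (y == x) => //; rewrite eqxx.
Qed.

Lemma laplacian_i p : D p -> D ('i *: p.1, 'i *: p.2).
Proof.
move=> [fin Dp]; split=> [|x].
  apply: sub_finite_set fin => x /=; apply: contra => /eqP fx.
  by rewrite -[X in X == _]/('i * p.1 x) fx mulr0.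
change ('i * p.2 x = laplacian b m (fun y => 'i * p.1 y) x).
rewrite Dp; have [s [us sx]] := neighbours x.
have s1 y : b x y != 0 -> y \in s by have [] := sx y.
rewrite !(laplacian_seq _ us s1) mulrCA; congr (_ * _); rewrite mulr_sumr.
by apply: eq_bigr => y _; rewrite mulrCA -mulrBr.
Qed.

Context (gamma : assumption_gamma b m).
Context (H_esa : essentially_self_adjoint H).
Let S := half_sum (closure D) (op_adjoint (closure D)).

Lemma ess_spectrum_laplacian (z : R[i]) :
  (forall t, t <= complex.Re z -> ~ ess_spectrum S t%:C) ->
  ~ ess_spectrum (closure D) z.
Proof.
have [M M0 aM] := gamma.
have aC x y : a y x = - a x y by rewrite /a opprB.
pose K : l2 m -> l2 m := kernel_op (ltW M0) aC skew_weight_finite aM.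
have KP (w : R[i]) f g : K (w *: f + g) = w *: K f + K g by exact: kernel_opP.
have KD f g : K (f + g) = K f + K g.
  by rewrite -[in LHS](scale1r f) KP scale1r.
have K0 : K 0 = 0 by have := KP (-1) 0 0; rewrite scaler0 addr0 scaleN1r addNr.
have KZ (w : R[i]) f : K (w *: f) = w *: K f.
  by rewrite -[in LHS](addr0 (w *: f)) KP K0 addr0.
have KB f g : K (f - g) = K f - K g by rewrite KD -scaleN1r KZ scaleN1r.
have Kskew f g : l2_rdot (K f) g = - l2_rdot f (K g) by exact: kernel_op_skew.
have hE := l2_hilbert m; pose A := closure H.
have DH p : D p <-> H (p.1, p.2 - K p.1) by exact: half_sum_laplacian.
have Hi p : H p -> H ('i *: p.1, 'i *: p.2).
  move=> Hp; have /DH/laplacian_i/DH/= : H ((p.1, p.2 + K p.1).1,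
      (p.1, p.2 + K p.1).2 - K (p.1, p.2 + K p.1).1).
    by rewrite /= addrK -surjective_pairing.
  by rewrite KZ -scalerBr addrK.
have Ai : forall p, A p -> A ('i *: p.1, 'i *: p.2) by exact: (closure_i hE Hi).
have Asa : selfadjoint_graph (@l2_rdot R V m) A.
  by move=> q; rewrite -{1}[A]H_esa; exact: op_adjoint_rdotP.
have A0 : forall p, A p -> 0 <= l2_rdot p.2 p.1.
  by apply: (closure_form_ge0 hE) => p; exact: half_sum_laplacian_ge0.
have [A00 AD AZ] := selfadjoint_real_graph hE Asa.
have DA p : closure D p <-> A (p.1, p.2 - K p.1).
  have -> : D = [set p | H (p.1, p.2 - K p.1)].
    by apply/seteqP; split=> q /DH.
  by rewrite (closure_shift hE (C := M / 2) H KB)// => f; exact: kernel_op_le.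
have Di p : closure D p -> closure D ('i *: p.1, 'i *: p.2).
  by move: p; apply: (closure_i hE); exact: laplacian_i.
have dense w : (forall p, A p -> l2_rdot p.1 w = 0) -> w = 0.
  move=> Aw; apply: l2_delta_dense.
  have Ax x : exists h, A (l2_delta m x, h).
    have [u /DH Hu] := laplacian_delta x.
    by eexists; apply: subset_closure; exact: Hu.
  move=> _ [[x _ <-]|[x _ <-]]; have [h Ah] := Ax x; first exact: (Aw _ Ah).
  exact: (Aw _ (Ai _ Ah)).
have -> : S = A.
  apply: (half_sum_skew hE Asa dense Kskew DA) => q.
  exact: op_adjoint_rdotP.
move=> noess; apply: (ess_spectrum_re_ge hE Asa A0 _ _ _ noess).
- split; first by apply/DA; rewrite /= K0 subr0.
    move=> p q /DA Ap /DA Aq; apply/DA; rewrite /= KD opprD addrACA.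
    exact: AD _ _ Ap Aq.
  by move=> r p /DA Ap; apply/DA; rewrite /= KZ -scalerBr; exact: AZ r _ Ap.
- exact: closed_closure.
- move=> p /DA Ap; exists (p.2 - K p.1) => //.
  have := Kskew p.1 p.1; rewrite (l2_rdotC p.1) => K2.
  have : l2_rdot (K p.1) p.1 = 0 by lra.
  by rewrite (rdotBl hE) => ->; rewrite subr0.
Qed.

End Graph.
Theorem proposition3p6 (R : realType) (V : countType) (E : rel V)
    (b : V -> V -> R) (m : V -> {posnum R}) :
  weighted_digraph E b ->
  digraph_connected E ->
  locally_finite E ->
  (forall x, exists y, E x y) ->
  assumption_beta b ->
  assumption_gamma b m ->
  let D := laplacian_op b m in
  let D' := laplacian_op (fun x y => b y x) m in
  let H := half_sum D D' in
  essentially_self_adjoint H ->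
  let S := half_sum (closure D) (op_adjoint (closure D)) in
  ess_spectrum (closure D) `<=`
    [set z | (ereal_inf [set t%:E | t in [set t : R | ess_spectrum S t%:C]] <=
              (complex.Re z)%:E)%E] /\
  (ess_spectrum S = set0 -> ess_spectrum (closure D) = set0).

Proof.
move=> wE _ lfE _ beta gamma D D' H H_esa S.
(* Both claims are contrapositives of this: in the first no [t <= Re z] can lie below the infimum
   and in the essential spectrum of [S], in the second there is no [t] at all. *)
have noess z := @ess_spectrum_laplacian R V E b m wE lfE beta gamma H_esa z.
split=> [z zD|S0]; last first.
  apply/seteqP; split=> // z; apply: noess => t _.
  by rewrite -/S S0.
rewrite /= leNgt; apply/negP => zlt; apply: noess zD => t tz St.
move: zlt; apply/negP; rewrite -leNgt.
apply: le_trans (_ : t%:E <= _)%E; last by rewrite lee_fin.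
by apply: ereal_inf_lbound; exists t.
Qed.
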